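(* Let $F$ be a field, let $\mathcal{A}$ be a finitely presented $F$-algebra that has a finite-dimensional representation, and let $m\ge 1$. Then $\mathcal{A}$ is rank-stable if and only if the matrix algebra $M_m(\mathcal{A})$ is rank-stable.
   Context: Algebras are associative and unital over a field $F$; $F\langle x_1,\dots,x_d\rangle$ denotes the free associative unital algebra (non-commutative polynomials). A finite-dimensional representation of an algebra is a unital algebra homomorphism to $M_n(F)$ for some $n\ge1$. (If $\mathcal{A}$ is finitely presented then so is $M_m(\mathcal{A})$.) For $A\in M_n(F)$ let $\operatorname{rank}(A)=\dim_F\operatorname{Im}A$ and let $\operatorname{rk}(A)=\frac1n\operatorname{rank}(A)$ (normalized rank). For $A\in M_n(F)$, $\widehat{A}$ is the finitely supported $\mathbb{N}\times\mathbb{N}$ matrix that agrees with $A$ in entries $(i,j)$ with $1\le i,j\le n$ and is zero elsewhere. When matrices in $M_n(F)$ are substituted into a non-commutative polynomial, constant terms are interpreted as scalar $n\times n$ matrices. A finitely presented algebra $F\langle x_1,\dots,x_d\rangle/\langle P_1,\dots,P_r\rangle$ is rank-stable if for every $\varepsilon>0$ there exists $\delta>0$ such that for every $n\ge 1$ and every tuple $A_1,\dots,A_d\in M_n(F)$ with $\operatorname{rk}P_i(A_1,\dots,A_d)<\delta$ for all $1\le i\le r$, there exist $n'\ge 1$ and $B_1,\dots,B_d\in M_{n'}(F)$ with $P_i(B_1,\dots,B_d)=0$ for all $1\le i\le r$ and $\operatorname{rank}(\widehat{A_i}-\widehat{B_i})<\varepsilon n$ for all $1\le i\le d$. (This property does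 not depend on the chosen finite presentation of the algebra.) *)

(* Defs.v *)
From HB Require Import structures.
From mathcomp Require Import all_boot all_order all_algebra.
From mathcomp Require Import reals.
From mathcomp Require Import monalg.

Set Implicit Arguments.
Unset Strict Implicit.
Unset Printing Implicit Defensive.

Import Order.TTheory GRing.Theory Num.Theory.

Local Open Scope ring_scope.

(* Positive matrix sizes are written n.+1, so that 'M[F]_n.+1 carries its
   (nontrivial) F-algebra structure. *)

(* F<x_0, ..., x_(d-1)>: the monoid algebra over F of the free monoid of words
   in d letters. *)
Notation ncpoly F d := {malg F[{fmonom 'I_d}]} (only parsing).

(* A constant term c is sent to c *: 1. *)
Definition nceval (F : fieldType) (d : nat) (S : algType F) (a : 'I_d -> S)
    (p : ncpoly F d) : S :=
  mmap (GRing.in_alg S) (fun w : {fmonom 'I_d} => \prod_(i <- w) a i) p.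

Definition in_ideal (F : fieldType) (d r : nat) (P : 'I_r -> ncpoly F d)
    (q : ncpoly F d) : Prop :=
  exists s : seq (ncpoly F d * 'I_r * ncpoly F d),
    q = \sum_(t <- s) t.1.1 * P t.1.2 * t.2.

(* A is isomorphic to F<x_0, ..., x_(d-1)> / <P_0, ..., P_(r-1)>, expressed by
   a surjective algebra morphism whose kernel is the ideal generated by P. *)
Definition presents (F : fieldType) (d r : nat) (P : 'I_r -> ncpoly F d)
    (A : algType F) : Prop :=
  exists phi : {lrmorphism ncpoly F d -> A},
    (forall a : A, exists q : ncpoly F d, phi q = a) /\
    (forall q : ncpoly F d, phi q = 0 <-> in_ideal P q).

Definition finitely_presented (F : fieldType) (A : algType F) : Prop :=
  exists (d r : nat) (P : 'I_r -> ncpoly F d), presents P A.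

Definition has_findim_rep (F : fieldType) (A : algType F) : Prop :=
  exists n : nat, inhabited {lrmorphism A -> 'M[F]_n.+1}.

Definition rk (R : realType) (F : fieldType) (n : nat) (A : 'M[F]_n.+1) : R :=
  (\rank A)%:R / n.+1%:R.

Definition hat (F : fieldType) (n : nat) (A : 'M[F]_n) (i j : nat) : F :=
  if insub i is Some i' then
    if insub j is Some j' then A i' j' else 0
  else 0.

(* Both hat A and hat B vanish outside the top left corner of size maxn n n',
   so the rank of their difference is the rank of that corner. *)
Definition rank_hat_sub (F : fieldType) (n n' : nat) (A : 'M[F]_n)
    (B : 'M[F]_n') : nat :=
  \rank (\matrix_(i < maxn n n', j < maxn n n') (hat A i j - hat B i j)).

Definition rank_stable_presentation (R : realType) (F : fieldType) (d r : nat)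
    (P : 'I_r -> ncpoly F d) : Prop :=
  forall eps : R, 0 < eps -> exists delta : R, 0 < delta /\
    forall (n : nat) (A : 'I_d -> 'M[F]_n.+1),
      (forall i : 'I_r, rk R (nceval A (P i)) < delta) ->
      exists (n' : nat) (B : 'I_d -> 'M[F]_n'.+1),
        (forall i : 'I_r, nceval B (P i) = 0) /\
        (forall i : 'I_d, (rank_hat_sub (A i) (B i))%:R < eps * n.+1%:R).

Definition rank_stable (R : realType) (F : fieldType) (A : algType F) : Prop :=
  exists (d r : nat) (P : 'I_r -> ncpoly F d),
    presents P A /\ rank_stable_presentation R P.

(* An alias is needed because 'M[A]_m.+1 already carries a module structure
   over A; here scalars in F act entrywise. *)
Definition matalg (F : fieldType) (A : algType F) (m : nat) := 'M[A]_m.+1.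

Section MatAlg.
Variables (F : fieldType) (A : algType F) (m : nat).
Local Notation MA := (matalg A m).

HB.instance Definition _ := GRing.NzRing.on MA.

Definition matalg_scale (c : F) (M : MA) : MA := \matrix_(i, j) (c *: M i j).

Fact matalg_scaleA (a b : F) (M : MA) :
  matalg_scale a (matalg_scale b M) = matalg_scale (a * b) M.
Proof. by apply/matrixP=> i j; rewrite !mxE scalerA. Qed.

Fact matalg_scale1 : left_id 1 matalg_scale.
Proof. by move=> M; apply/matrixP=> i j; rewrite mxE scale1r. Qed.

Fact matalg_scaleDr : right_distributive matalg_scale +%R.
Proof. by move=> c M N; apply/matrixP=> i j; rewrite !mxE scalerDr. Qed.

Fact matalg_scaleDl (M : MA) : {morph matalg_scale^~ M : a b / a + b}.
Proof. by move=> a b; apply/matrixP=> i j; rewrite !mxE scalerDl. Qed.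

HB.instance Definition _ := GRing.Zmodule_isLmodule.Build F MA
  matalg_scaleA matalg_scale1 matalg_scaleDr matalg_scaleDl.

Fact matalg_scaleAl (c : F) (M N : MA) : c *: (M * N) = (c *: M) * N.
Proof.
apply/matrixP=> i j; rewrite !mxE scaler_sumr.
by apply: eq_bigr => k _; rewrite mxE scalerAl.
Qed.

HB.instance Definition _ := GRing.Lmodule_isLalgebra.Build F MA matalg_scaleAl.

Fact matalg_scaleAr (c : F) (M N : MA) : c *: (M * N) = M * (c *: N).
Proof.
apply/matrixP=> i j; rewrite !mxE scaler_sumr.
by apply: eq_bigr => k _; rewrite mxE scalerAr.
Qed.

HB.instance Definition _ := GRing.Lalgebra_isAlgebra.Build F MA matalg_scaleAr.

End MatAlg.

(* Main.v *)
(* Close tuples (X_i) of size n and (B_i) of size n' are compared through maps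
   S : F^n -> F^n' and T back such that ST - 1, TS - 1 and all X_i S - S B_i
   have small rank (row vectors throughout).  Such pairs survive evaluation of a
   polynomial up to a constant factor, and they amount to the comparison of
   corners in the definition of rank-stability: an almost invertible S can be
   perturbed to an invertible one, by which B is conjugated, and conversely an
   exact solution B of the wrong size n' whose corner is close to X can be cut
   down to the span of F^n and of the images of the differences (n < n'), or
   padded by zeros (n' < n), unless a nonzero constant term already forces
   n - n' to be small.
   With this notion both implications are Morita arguments.  From an approximate
   representation X of A one gets the approximate representation of M_m(A) on
   (F^n)^m; the image of e_11 in a nearby exact one is a representation of A near
   X.  Conversely, present M_m(A) by generators of A and matrix units e_jk; given
   an approximate representation, the image of e_11 carries an approximate
   representation of A, and m copies of a nearby exact one form an exact
   representation of M_m(A). *)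
From HB Require Import structures.
Require Import Defs.
From mathcomp Require Import all_boot all_order all_algebra.
From mathcomp Require Import reals.
From mathcomp Require Import monalg zify.

Set Implicit Arguments.
Unset Strict Implicit.
Unset Printing Implicit Defensive.

Import Order.TTheory GRing.Theory Num.Theory.

Local Open Scope ring_scope.

Lemma sum_mulrb (V : zmodType) (I : finType) (a : I) (f : I -> V) :
  \sum_i f i *+ (i == a) = f a.
Proof.
rewrite (bigD1 a) //= big1 ?addr0 ?eqxx // => i nia.
by rewrite (negPf nia).
Qed.

Lemma commMr (R : pzRingType) (a p q : R) :
  a * (p * q) - p * q * a = (a * p - p * a) * q + p * (a * q - q * a).
Proof. by rewrite mulrBl mulrBr !mulrA subrKA. Qed.

(** * Evaluation and substitution in the free algebra *)

Section NcpolyAlgebra.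
Variables (F : fieldType) (d : nat).

Fact ncpoly_scaleAr (c : F) (p q : ncpoly F d) : c *: (p * q) = p * (c *: q).
Proof.
rewrite malgM_def fgmulEr1 scaler_sumr.
rewrite [in RHS](malgM_def) [in RHS](fgmulrwl (msuppZ_le c q)).
apply: eq_bigr => k _; rewrite fgmulgU scaler_sumr; apply: eq_bigr => l _.
apply/malgP => u; rewrite mcoeffZ [in LHS]mcoeffU [RHS]mcoeffU mcoeffZ.
by rewrite mulrCA mulrnAr.
Qed.

(* An alias, because the algebra structure that the library attaches to malg
   itself is the one for commutative monoids. *)
Definition ncalg : Type := ncpoly F d.
HB.instance Definition _ := GRing.Lalgebra.on ncalg.
HB.instance Definition _ :=
  GRing.Lalgebra_isAlgebra.Build F ncalg ncpoly_scaleAr.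

End NcpolyAlgebra.

(* Locked, so that failed rewrites do not unfold the product of malg. *)
HB.lock Definition ncvar (F : fieldType) (d : nat) (i : 'I_d) : ncpoly F d :=
  << fmu i >>.

Section NcpolyTheory.
Variables (F : fieldType) (d : nat).
Local Notation ncvar := (@ncvar F d).

(** A polynomial is a linear combination of words, and a word grows by prepending letters. The only
    product case is multiplication by one letter, so facts about evaluation are checked one
    generator at a time. *)
Lemma ncpoly_ind (Q : ncpoly F d -> Prop) :
  Q 0 -> Q 1 -> (forall c p q, Q p -> Q q -> Q (c *: p + q)) ->
  (forall i p, Q p -> Q (ncvar i * p)) -> forall p, Q p.
Proof.
move=> Q0 Q1 QZD QX p; rewrite (monalgE p).
elim/big_rec: _ => // k q _ Qq.
have -> : << p@_k *g k >> = p@_k *: << k >> :> ncpoly F d.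
  by apply/malgP=> l; rewrite mcoeffZ [LHS]mcoeffU mcoeffU mulr_natr.
apply: QZD => // {q Qq}.
case: k => w; elim: w => [|i w IH].
  by rewrite -fmoneE.
have -> : << FMonom (i :: w) >> = ncvar i * << FMonom w >> :> ncpoly F d.
  by rewrite unlock malgM_def fgmulUU mulr1 /mmul /= fmuE fmmulE.
exact: QX.
Qed.

Variables (S : algType F) (a : 'I_d -> S).

Fact nceval_additive : additive (nceval a).
Proof. by move=> p q; rewrite /nceval mmapB. Qed.

Let wordeval (w : {fmonom 'I_d}) := \prod_(i <- w) a i.

Fact wordeval_mmorphism : mmorphism wordeval.
Proof.
split=> [u v|]; rewrite /wordeval.
  by rewrite fmM big_cat.
by rewrite fm1 big_nil.
Qed.
HB.instance Definition _ := isMultiplicative.Build _ _ wordeval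
  wordeval_mmorphism.

Fact nceval_multiplicative : multiplicative (nceval a).
Proof.
apply: (@commr_mmap_is_multiplicative _ _ _ (GRing.in_alg S) wordeval).
by move=> p u v; rewrite /GRing.comm /= mulr_algl mulr_algr.
Qed.

Fact nceval_scalable : scalable (nceval a).
Proof.
move=> c p; rewrite /nceval.
by rewrite (@mmapZ _ _ _ (GRing.in_alg S) wordeval) /= mulr_algl.
Qed.

HB.instance Definition _ := GRing.isAdditive.Build _ _ (nceval a)
  nceval_additive.
HB.instance Definition _ := GRing.isMultiplicative.Build _ _ (nceval a)
  nceval_multiplicative.
HB.instance Definition _ := GRing.isScalable.Build F _ _ _ (nceval a)
  nceval_scalable.

Lemma nceval_var i : nceval a (ncvar i) = a i.
Proof.
by rewrite unlock /nceval mmapU /= scale1r mul1r fmU big_seq1.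
Qed.

End NcpolyTheory.

(** Substitution is evaluation in the target free algebra, seen as [ncalg] so that it is an
    [algType]. *)
HB.lock Definition ncsubst (F : fieldType) (d d' : nat)
    (h : 'I_d -> ncpoly F d') (p : ncpoly F d) : ncpoly F d' :=
  nceval (S := ncalg F d') h p.

Section Substitution.
Variables (F : fieldType) (d d' : nat) (h : 'I_d -> ncpoly F d').

Fact ncsubst_additive : additive (ncsubst h).
Proof. rewrite unlock; exact: (@nceval_additive F d (ncalg F d') h). Qed.
Fact ncsubst_multiplicative : multiplicative (ncsubst h).
Proof. rewrite unlock; exact: (@nceval_multiplicative F d (ncalg F d') h). Qed.
Fact ncsubst_scalable : scalable (ncsubst h).
Proof. rewrite unlock; exact: (@nceval_scalable F d (ncalg F d') h). Qed.

HB.instance Definition _ := GRing.isAdditive.Build _ _ (ncsubst h)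
  ncsubst_additive.
HB.instance Definition _ := GRing.isMultiplicative.Build _ _ (ncsubst h)
  ncsubst_multiplicative.
HB.instance Definition _ := GRing.isScalable.Build F _ _ _ (ncsubst h)
  ncsubst_scalable.

Lemma ncsubst_var i : ncsubst h (ncvar F i) = h i.
Proof. rewrite unlock; exact: (@nceval_var F d (ncalg F d') h). Qed.

Lemma nceval_subst (S : algType F) (b : 'I_d' -> S) p :
  nceval b (ncsubst h p) = nceval (fun i => nceval b (h i)) p.
Proof.
elim/ncpoly_ind: p => [|| c p q IHp IHq | i p IH].
- by rewrite !rmorph0.
- by rewrite !rmorph1.
- by rewrite !linearP /= IHp IHq.
- by rewrite !rmorphM /= ncsubst_var nceval_var IH.
Qed.

End Substitution.

(** * Matrices up to small rank *)

(** The bound is an unnormalized integer and the matrices may be rectangular, so errors of maps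
    between spaces of different dimensions simply add. *)
Definition apx (F : fieldType) (k m n : nat) (A B : 'M[F]_(m, n)) : bool :=
  (\rank (A - B)%R <= k)%N.

Section Apx.
Variable F : fieldType.

Lemma apx_refl k m n (A : 'M[F]_(m, n)) : apx k A A.
Proof. by rewrite /apx subrr mxrank0. Qed.

Lemma apx_sym k m n (A B : 'M[F]_(m, n)) : apx k A B -> apx k B A.
Proof. by rewrite /apx -opprB mxrank_opp. Qed.

Lemma apx_le k l m n (A B : 'M[F]_(m, n)) : (k <= l)%N -> apx k A B -> apx l A B.
Proof. by move=> kl /leq_trans; apply. Qed.

Lemma apx_trans k l m n (B A C : 'M[F]_(m, n)) :
  apx k A B -> apx l B C -> apx (k + l) A C.
Proof.
rewrite /apx => AB BC; rewrite -(subrKA B).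
exact: leq_trans (mxrank_add _ _) (leq_add AB BC).
Qed.

Lemma apx_mull k l m n (P : 'M[F]_(l, m)) (A B : 'M[F]_(m, n)) :
  apx k A B -> apx k (P *m A) (P *m B).
Proof.
by rewrite /apx -mulmxBr; apply: leq_trans; apply: mxrankM_maxr.
Qed.

Lemma apx_mulr k l m n (P : 'M[F]_(n, l)) (A B : 'M[F]_(m, n)) :
  apx k A B -> apx k (A *m P) (B *m P).
Proof.
by rewrite /apx -mulmxBl; apply: leq_trans; apply: mxrankM_maxl.
Qed.

Lemma apxD k l m n (A B C D : 'M[F]_(m, n)) :
  apx k A B -> apx l C D -> apx (k + l) (A + C) (B + D).
Proof.
rewrite /apx => AB CD; rewrite opprD addrACA.
exact: leq_trans (mxrank_add _ _) (leq_add AB CD).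
Qed.

Lemma apxZ k m n (c : F) (A B : 'M[F]_(m, n)) :
  apx k A B -> apx k (c *: A) (c *: B).
Proof. by rewrite /apx -scalerBr; apply: leq_trans; apply: mxrank_scale. Qed.

Lemma apx_sum (I : finType) k m n (A B : I -> 'M[F]_(m, n)) :
  (forall i, apx k (A i) (B i)) -> apx (#|I| * k) (\sum_i A i) (\sum_i B i).
Proof.
move=> AB; rewrite -sum_nat_const.
elim/big_rec3: _ => [|i t B' A' _ IH]; first exact: apx_refl.
exact: apxD (AB i) IH.
Qed.

Lemma apx_sum_ord l k m n (A B : 'I_l -> 'M[F]_(m, n)) :
  (forall i, apx k (A i) (B i)) -> apx (l * k) (\sum_i A i) (\sum_i B i).
Proof. by move=> /apx_sum; rewrite card_ord. Qed.

Lemma apx0 k m n (A : 'M[F]_(m, n)) : apx k A 0 = (\rank A <= k)%N.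
Proof. by rewrite /apx subr0. Qed.

Lemma apx0_eq m n (A B : 'M[F]_(m, n)) : apx 0 A B -> A = B.
Proof. by rewrite /apx leqn0 mxrank_eq0 subr_eq0 => /eqP. Qed.

Lemma apx_rank k m n (A B : 'M[F]_(m, n)) :
  apx k A B -> (\rank A <= \rank B + k)%N.
Proof.
move=> AB; rewrite -apx0 addnC; apply: apx_trans AB _.
by rewrite apx0.
Qed.

(** Each letter of each word moves past [S] at cost [k], and further factors do not raise the rank
    of the error. So [C] depends on [p] alone, not on the sizes. *)
Lemma nceval_intertwine_apx d (p : ncpoly F d) :
  exists C, forall n n' (X : 'I_d -> 'M[F]_n.+1) (X' : 'I_d -> 'M[F]_n'.+1)
      (S : 'M[F]_(n.+1, n'.+1)) k,
    (forall i, apx k (X i *m S) (S *m X' i)) ->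
    apx (C * k) (nceval X p *m S) (S *m nceval X' p).
Proof.
elim/ncpoly_ind: p => [|| c p q [C HC] [D HD] | i p [C HC]].
- by exists 0%N => *; rewrite !rmorph0 mul0mx mulmx0 apx_refl.
- by exists 0%N => *; rewrite !rmorph1 mul1mx mulmx1 apx_refl.
- exists (C + D)%N => n n' X X' S k XS.
  rewrite !rmorphD /= !linearZ /= mulmxDl mulmxDr -scalemxAl -scalemxAr mulnDl.
  by apply: apxD; [apply/apxZ/HC | apply: HD].
- exists C.+1 => n n' X X' S k XS.
  rewrite !rmorphM /= !nceval_var -!mulmxE mulSn addnC.
  rewrite -[X in apx _ X _]mulmxA.
  apply: apx_trans (apx_mull _ (HC _ _ _ _ _ _ XS)) _.
  by rewrite !mulmxA; apply: apx_mulr.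
Qed.

Lemma nceval_intertwine d (p : ncpoly F d) n n' (X : 'I_d -> 'M[F]_n.+1)
    (X' : 'I_d -> 'M[F]_n'.+1) (S : 'M[F]_(n.+1, n'.+1)) :
  (forall i, X i *m S = S *m X' i) -> nceval X p *m S = S *m nceval X' p.
Proof.
have [C HC] := nceval_intertwine_apx p.
move=> XS; apply: apx0_eq; rewrite -(muln0 C).
by apply: HC => i; rewrite XS apx_refl.
Qed.

(** Each summand of [q] has one [P j] as a factor, so its rank is at most [k]; [C] is the number of
    summands. *)
Lemma rank_nceval_ideal d r (P : 'I_r -> ncpoly F d) q : in_ideal P q ->
  exists C, forall n (X : 'I_d -> 'M[F]_n.+1) k,
    (forall j, \rank (nceval X (P j)) <= k)%N ->
    (\rank (nceval X q) <= C * k)%N.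
Proof.
case=> s ->; exists (size s) => n X k Pk; elim: s => [|t s IH].
  by rewrite big_nil rmorph0 mxrank0.
rewrite big_cons rmorphD !rmorphM /= mulSn.
apply: leq_trans (mxrank_add _ _) (leq_add _ IH).
rewrite -!mulmxE; apply: leq_trans (mxrankM_maxl _ _) _.
exact: leq_trans (mxrankM_maxr _ _) (Pk _).
Qed.

Lemma nceval_ideal d r (P : 'I_r -> ncpoly F d) q (S : algType F)
    (a : 'I_d -> S) :
  (forall j, nceval a (P j) = 0) -> in_ideal P q -> nceval a q = 0.
Proof.
move=> P0 [s ->]; rewrite rmorph_sum big1 // => t _.
by rewrite !rmorphM /= P0 mulr0 mul0r.
Qed.

(** Merges the constants found for each of finitely many relations or generators into one. *)
Lemma unif_bound (I : finType) (Q : I -> nat -> Prop) :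
  (forall i k l, (k <= l)%N -> Q i k -> Q i l) ->
  (forall i, exists k, Q i k) -> exists k, forall i, Q i k.
Proof.
move=> Qle /fin_all_exists[f Qf]; exists (\max_i f i) => i.
exact: Qle (leq_bigmax i) (Qf i).
Qed.

Definition close d k n n' (X : 'I_d -> 'M[F]_n.+1) (X' : 'I_d -> 'M[F]_n'.+1) :=
  exists (S : 'M[F]_(n.+1, n'.+1)) (T : 'M[F]_(n'.+1, n.+1)),
    [/\ apx k (S *m T) 1%:M, apx k (T *m S) 1%:M
      & forall i, apx k (X i *m S) (S *m X' i)].

(** Rank-stability in integers: [1/e] plays the role of epsilon and [1/D] that of delta, and [close]
    replaces the comparison of corners. *)
Definition nat_stable d r (P : 'I_r -> ncpoly F d) :=
  forall e, exists D, forall n (X : 'I_d -> 'M[F]_n.+1) p,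
    (forall j, \rank (nceval X (P j)) <= p)%N -> (D * p <= n.+1)%N ->
    exists n' (B : 'I_d -> 'M[F]_n'.+1) k,
      [/\ forall j, nceval B (P j) = 0, close k X B & (e * k <= n.+1)%N].

End Apx.

(** * Comparing matrices of different sizes *)

Section Corner.
Variable F : fieldType.

(** Turns the corner into a product with truncated identities, to which rank inequalities for
    products apply. *)
Lemma matrix_hatE n N (A : 'M[F]_n) : (n <= N)%N ->
  \matrix_(i < N, j < N) hat A i j = pid_mx n *m A *m pid_mx n.
Proof.
move=> nN; apply/matrixP=> i j; rewrite !mxE.
have pidl (a : 'I_n) : (pid_mx n *m A) i a =
    if insub (i : nat) is Some i' then A i' a else 0.
  rewrite mxE; case: insubP => [i' lti def_i | gei].
    rewrite (bigD1 i') //= big1 => [|b]; rewrite !mxE -?def_i.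
      by rewrite eqxx ltn_ord mul1r addr0.
    by rewrite eq_sym -val_eqE /= => /negPf->; rewrite mul0r.
  by rewrite big1 // => b _; rewrite !mxE (negPf gei) andbF mul0r.
rewrite /hat; case: (insubP _ (j : nat)) => [j' ltj def_j | gej].
  rewrite (bigD1 j') //= big1 => [|b nbj].
    rewrite pidl mxE -def_j eqxx ltn_ord mulr1 addr0.
    by case: insubP.
  by rewrite [X in _ * X]mxE -def_j (inj_eq val_inj) (negPf nbj) mulr0.
rewrite big1 => [|b _]; first by case: insub.
rewrite [X in _ * X]mxE; case: eqP => [bj|]; last by rewrite mulr0.
by case/negP: gej; rewrite -bj.
Qed.

Lemma pid_section n N : (n <= N)%N ->
  (pid_mx n : 'M[F]_(n, N)) *m (pid_mx n : 'M_(N, n)) = 1%:M.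
Proof.
by move=> nN; rewrite mul_pid_mx minnn (minn_idPr nN) pid_mx_1.
Qed.

Lemma apx_pid n N : (n <= N)%N ->
  apx (N - n) ((pid_mx n : 'M[F]_(N, n)) *m (pid_mx n : 'M_(n, N))) 1%:M.
Proof.
move=> nN; apply: apx_sym; rewrite /apx mul_pid_mx !minnn.
by rewrite -/(copid_mx n) rank_copid_mx.
Qed.

Lemma rank_hat_subE n n' (A : 'M[F]_n) (B : 'M[F]_n') :
  let N := maxn n n' in
  rank_hat_sub A B =
    \rank ((pid_mx n : 'M_(N, n)) *m A *m (pid_mx n : 'M_(n, N)) -
           (pid_mx n' : 'M_(N, n')) *m B *m (pid_mx n' : 'M_(n', N)))%R.
Proof.
rewrite /rank_hat_sub -!matrix_hatE ?leq_maxl ?leq_maxr //.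
by congr (\rank _); apply/matrixP => i j; rewrite !mxE.
Qed.

(* J and J' are the truncated identity matrices of sizes n x n' and n' x n. *)
Lemma rank_hat_sub_intertwine n n' :
  exists (J : 'M[F]_(n, n')) (J' : 'M[F]_(n', n)),
  [/\ apx (n - n') (J *m J') 1%:M,
      apx (n' - n) (J' *m J) 1%:M,
      forall A B k, apx k (A *m J) (J *m B) ->
        (rank_hat_sub A B <= k + ((n - n') + (n' - n)))%N
    & forall A B,
      [/\ apx (rank_hat_sub A B) (A *m J) (J *m B),
          apx (rank_hat_sub A B) (J' *m A *m J) B
        & apx (rank_hat_sub A B) A (J *m B *m J')]].
Proof.
pose N := maxn n n'.
pose K : 'M[F]_(n, N) := pid_mx n; pose K' : 'M[F]_(N, n) := pid_mx n.
pose L : 'M[F]_(n', N) := pid_mx n'; pose L' : 'M[F]_(N, n') := pid_mx n'.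
have KK : K *m K' = 1%:M by apply/pid_section/leq_maxl.
have LL : L *m L' = 1%:M by apply/pid_section/leq_maxr.
have K'K : apx (n' - n) (K' *m K) 1%:M.
  by apply: apx_le (apx_pid (leq_maxl _ _)); rewrite /N; lia.
have L'L : apx (n - n') (L' *m L) 1%:M.
  by apply: apx_le (apx_pid (leq_maxr _ _)); rewrite /N; lia.
have rhE A B : apx (rank_hat_sub A B) (K' *m A *m K) (L' *m B *m L).
  by rewrite rank_hat_subE; apply: leqnn.
have rhE' A B k : apx k (K' *m A *m K) (L' *m B *m L) ->
  (rank_hat_sub A B <= k)%N by rewrite rank_hat_subE.
(* Only these relations are used below, so the truncated identities are generalized. [J] and [J']
   are then defined by passing through the common size [N]. *)
move: K K' L L' KK LL K'K L'L rhE rhE' => K K' L L' KK LL K'K L'L rhE rhE'.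
exists (K *m L'), (L *m K'); split.
- rewrite -KK -[X in apx _ _ (X *m _)]mulmx1 !mulmxA.
  by apply: apx_mulr; rewrite -!mulmxA; apply: apx_mull.
- rewrite -LL -[X in apx _ _ (X *m _)]mulmx1 !mulmxA.
  by apply: apx_mulr; rewrite -!mulmxA; apply: apx_mull.
- move=> A B k /(apx_mull K')/(apx_mulr L) AB; apply: rhE'.
  have E1 : apx (n - n') (K' *m A *m K) (K' *m (A *m (K *m L')) *m L).
    rewrite -[X in apx _ X _]mulmx1 !mulmxA -[_ *m L' *m L]mulmxA.
    exact/apx_mull/apx_sym.
  have E2 : apx (n' - n) (K' *m (K *m L' *m B) *m L) (L' *m B *m L).
    by rewrite -[L' in apx _ _ (L' *m _ *m _)]mul1mx !mulmxA; do 3!apply/apx_mulr.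
  by rewrite addnCA; apply: apx_trans E1 (apx_trans AB E2).
- move=> A B; split.
  + have := apx_mulr L' (apx_mull K (rhE A B)).
    by rewrite !mulmxA KK mul1mx -[_ *m L *m L']mulmxA LL mulmx1.
  + have := apx_mulr L' (apx_mull L (rhE A B)).
    by rewrite !mulmxA LL mul1mx -[_ *m L *m L']mulmxA LL mulmx1.
  + have := apx_mulr K' (apx_mull K (rhE A B)).
    by rewrite !mulmxA KK mul1mx -[_ *m K *m K']mulmxA KK mulmx1.
Qed.

End Corner.

Section Closeness.
Variable F : fieldType.

Lemma close_le d k l n n' (X : 'I_d -> 'M[F]_n.+1) (X' : 'I_d -> 'M[F]_n'.+1) :
  (k <= l)%N -> close k X X' -> close l X X'.
Proof.
move=> kl [S [T [ST TS XS]]]; exists S, T.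
by split=> [||i]; apply: apx_le kl _.
Qed.

(** In the factorization of [M] through [pid_mx (\rank M)] with invertible outer factors, the middle
    factor is replaced by the identity. *)
Lemma unitmx_near n (M : 'M[F]_n) :
  exists2 G, G \in unitmx & apx (n - \rank M) G M.
Proof.
exists (col_ebase M *m row_ebase M).
  by rewrite unitmx_mul col_ebase_unit row_ebase_unit.
rewrite -{4}[M]mulmx_ebase -[X in apx _ (X *m _)]mulmx1.
apply/apx_mulr/apx_mull; rewrite /apx -/(copid_mx _).
by rewrite rank_copid_mx ?rank_leq_row.
Qed.

Lemma close_size d k n n' (X : 'I_d -> 'M[F]_n.+1) (X' : 'I_d -> 'M[F]_n'.+1) :
  close k X X' -> (n <= n' + k)%N /\ (n' <= n + k)%N.
Proof.
case=> S [T [/apx_sym/apx_rank ST /apx_sym/apx_rank TS _]].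
rewrite !mxrank1 in ST TS; rewrite -ltnS -(ltnS n'); split.
  apply: leq_trans ST _; rewrite -addSn leq_add2r.
  exact: leq_trans (mxrankM_maxl _ _) (rank_leq_col _).
apply: leq_trans TS _; rewrite -addSn leq_add2r.
exact: leq_trans (mxrankM_maxl _ _) (rank_leq_col _).
Qed.

(** [S] is near [J *m G] with [G] invertible, and [B'] is the conjugate of [B] by [G], which
    satisfies the same exact relations. Of the [9 * k], [7 * k] is the intertwining error and at
    most [k] comes from each truncated difference of the sizes. *)
Lemma close_rank_hat d k n n' (X : 'I_d -> 'M[F]_n.+1)
    (B : 'I_d -> 'M[F]_n'.+1) : close k X B ->
  exists B' : 'I_d -> 'M[F]_n'.+1,
    (forall p, nceval B p = 0 -> nceval B' p = 0) /\
    (forall i, rank_hat_sub (X i) (B' i) <= 9 * k)%N.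
Proof.
move=> XB; have [le_n le_n'] := close_size XB; case: XB => S [T [_ TS XS]].
have [J [J' [JJ' _ rh _]]] := rank_hat_sub_intertwine F n.+1 n'.+1.
have {}JJ' : apx k (J *m J') 1%:M by apply: apx_le JJ'; lia.
have rS : (n'.+1 <= \rank S + k)%N.
  have := apx_rank (apx_sym TS); rewrite mxrank1 => /leq_trans; apply.
  by rewrite leq_add2r mxrankM_maxr.
have JJ'S : apx k (J *m (J' *m S)) S.
  by rewrite mulmxA -{2}[S]mul1mx; apply: apx_mulr.
have rJS : (\rank S <= \rank (J' *m S) + k)%N.
  apply: leq_trans (apx_rank (apx_sym JJ'S)) _.
  by rewrite leq_add2r mxrankM_maxr.
have [G uG GJS] := unitmx_near (J' *m S).
(* [S] misses full column rank by at most [k] and [J' *m S] by at most [2 * k], which bounds the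
   distance from [G] to [J' *m S]. *)
have JG : apx (3 * k) (J *m G) S.
  apply: (@apx_le _ (2 * k + k)); first lia.
  apply: apx_trans JJ'S; apply: apx_mull; apply: apx_le GJS; lia.
exists (fun i => G *m B i *m invmx G); split=> [p p0 | i].
  have: nceval (fun i => G *m B i *m invmx G) p *m G = G *m nceval B p.
    by apply: nceval_intertwine => i; rewrite mulmxKV.
  by rewrite p0 mulmx0 => /(congr1 (mulmxr (invmx G))); rewrite /= mulmxK ?mul0mx.
have: apx (7 * k) (X i *m J) (J *m (G *m B i *m invmx G)).
  rewrite -[X i *m J](mulmxK uG) !mulmxA; apply: apx_mulr.
  apply: (@apx_le _ (3 * k + (k + 3 * k))); first lia.
  rewrite -[X in apx _ X _]mulmxA; apply: apx_trans (apx_mull _ JG) _.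
  by apply: apx_trans (XS i) _; apply/apx_mulr/apx_sym.
move=> /rh /leq_trans; apply; lia.
Qed.

(** Full-rank factorization with one-sided inverses. As [W] is nonzero, the inner size is a
    successor, as needed for matrices of that size to form an algebra. *)
Lemma rank_factor m n (W : 'M[F]_(m, n)) : W != 0 ->
  exists w (R : 'M_(w.+1, n)) (C : 'M_(m, w.+1)) (R' : 'M_(n, w.+1))
    (C' : 'M_(w.+1, m)),
    [/\ C *m R = W, R *m R' = 1%:M, C' *m C = 1%:M & w.+1 = \rank W].
Proof.
rewrite -mxrank_eq0 -lt0n.
have /row_freeP[R' RR'] := row_base_free W.
have /row_fullP[C' CC'] := col_base_full W.
move: (row_base W) (col_base W) R' C' (mulmx_base W) RR' CC'.
case: (\rank W) => // w R C R' C' *.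
by exists w, R, C, R', C'.
Qed.

(** [S] has rank at least [n] and annihilates [T *m S - 1], so the latter has rank at most
    [w - n]. *)
Lemma apx_section n w (S : 'M[F]_(n, w)) (T : 'M[F]_(w, n)) :
  S *m T = 1%:M -> apx (w - n) (T *m S) 1%:M.
Proof.
move=> ST; have rS : (n <= \rank S)%N.
  by apply: leq_trans (mxrankM_maxl S T); rewrite ST mxrank1.
have ST0 : S *m (T *m S - 1%:M) = 0.
  by rewrite mulmxBr mulmx1 mulmxA ST mul1mx subrr.
rewrite /apx; apply: leq_trans (leq_sub2l _ rS).
by rewrite -(leq_add2l (\rank S)) subnKC ?rank_leq_col ?mulmx0_rank_max.
Qed.

(** The row space of [R] is invariant under [B], and [R *m B i *m R'] is the restricted action. *)
Lemma nceval_sub_section d n w (B : 'I_d -> 'M[F]_n.+1)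
    (R : 'M[F]_(w.+1, n.+1)) (R' : 'M[F]_(n.+1, w.+1)) p :
  R *m R' = 1%:M -> (forall i, R *m B i *m R' *m R = R *m B i) ->
  nceval (fun i => R *m B i *m R') p = R *m nceval B p *m R'.
Proof.
move=> RR' inv; rewrite -(nceval_intertwine p inv).
by rewrite -mulmxA RR' mulmx1.
Qed.

(** The scalar is the constant term of [p], hence the same in all sizes. *)
Lemma nceval_zero d (p : ncpoly F d) :
  exists c, forall n, nceval (fun _ => 0 : 'M[F]_n.+1) p = c%:M.
Proof.
elim/ncpoly_ind: p => [|| c p q [a Ha] [b Hb] | i p _].
- by exists 0 => n; rewrite rmorph0 raddf0.
- by exists 1 => n; rewrite rmorph1.
- by exists (c * a + b) => n; rewrite linearP /= Ha Hb scale_scalar_mx raddfD.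
- by exists 0 => n; rewrite rmorphM /= nceval_var mul0r raddf0.
Qed.

(* The representation B restricts to the span of the first n coordinates and of
   the images of the small matrices B_i - A_i, which contains every image. *)
Lemma close_of_hat_le d h n n' (X : 'I_d -> 'M[F]_n.+1)
    (B : 'I_d -> 'M[F]_n'.+1) : (n <= n')%N ->
  (forall i, rank_hat_sub (X i) (B i) <= h)%N ->
  exists w (B' : 'I_d -> 'M[F]_w.+1),
    (forall p, nceval B p = 0 -> nceval B' p = 0) /\ close (d.+1 * h) X B'.
Proof.
move=> nn' hX.
have [J [J' [JJ' _ _ rh]]] := rank_hat_sub_intertwine F n.+1 n'.+1.
have {}JJ' : J *m J' = 1%:M by apply: apx0_eq; apply: apx_le JJ'; lia.
pose H i := B i - J' *m X i *m J.
have rH i : (\rank (H i) <= h)%N.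
  apply: leq_trans (hX i); by have [_ /apx_sym] := rh (X i) (B i).
pose W := (J + \sum_i <<H i>>)%MS.
have rW : (\rank W <= n.+1 + d * h)%N.
  apply: leq_trans (mxrank_adds_leqif _ _) _.
  apply: leq_add (rank_leq_row _) _.
  rewrite -[d in (d * h)%N]card_ord -sum_nat_const.
  elim/big_rec2: _ => [|i0 k A _ IH]; first by rewrite mxrank0.
  apply: leq_trans (mxrank_adds_leqif _ _) (leq_add _ IH).
  by rewrite mxrank_gen rH.
have JW : (J <= W)%MS by rewrite addsmxSl.
have W0 : W != 0.
  apply/eqP => W0; move: JW; rewrite W0 submx0 => /eqP J0.
  by have := mxrank1 F n.+1; rewrite -JJ' J0 mul0mx mxrank0.
have [w [R [C [R' [C' [CR RR' CC' rankW]]]]]] := rank_factor W0.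
have WR : (R :=: W)%MS.
  apply/eqmxP/andP; rewrite -CR submxMl.
  by rewrite -[R in (R <= _)%MS]mul1mx -CC' -mulmxA submxMl.
have subR m (Y : 'M_(m, _)) : (Y <= W)%MS -> Y *m R' *m R = Y.
  by rewrite -WR => /submxP[D ->]; rewrite -(mulmxA D) RR' mulmx1.
(* [B i] is the sum of [H i] and [J' *m X i *m J]; the image of the first lies in [W] by
   construction, that of the second in the row space of [J]. *)
have inv i : R *m B i *m R' *m R = R *m B i.
  apply: subR; rewrite -[B i](subrK (J' *m X i *m J)) -/(H i) mulmxDr.
  rewrite addmx_sub //; last by rewrite !mulmxA mulmx_sub.
  rewrite mulmx_sub // (submx_trans _ (addsmxSr _ _)) //.
  by rewrite (sumsmx_sup i) // genmxE.
exists w, (fun i => R *m B i *m R'); split=> [p p0|].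
  by rewrite nceval_sub_section // p0 mulmx0 mul0mx.
exists (J *m R'), (R *m J').
have ST : J *m R' *m (R *m J') = 1%:M by rewrite mulmxA subR.
split=> [||i]; first by rewrite ST apx_refl.
  (* The rank of [W] exceeds [n.+1] by at most [d * h]. *)
  by apply: apx_le (apx_section ST); lia.
apply: (@apx_le _ h); first lia.
rewrite !mulmxA subR //; apply: apx_mulr; apply: apx_le (hX i) _.
by have [] := rh (X i) (B i).
Qed.

(** [J] intertwines the padded tuple with [B], and the projection [1 - J J'] intertwines it with the
    zero tuple, where [p] takes its constant term; both parts add up to the identity. *)
Lemma nceval_dilate d n n' (B : 'I_d -> 'M[F]_n'.+1)
    (J : 'M[F]_(n.+1, n'.+1)) (J' : 'M[F]_(n'.+1, n.+1)) p c :
  J' *m J = 1%:M -> nceval (fun _ => 0 : 'M[F]_n.+1) p = c%:M ->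
  nceval (fun i => J *m B i *m J') p =
    J *m nceval B p *m J' + c *: (1%:M - J *m J').
Proof.
move=> J'J p0; set Y := fun i => _.
have YJ : nceval Y p *m J = J *m nceval B p.
  by apply: nceval_intertwine => i; rewrite -mulmxA J'J mulmx1.
have YQ : nceval Y p *m (1%:M - J *m J') = (1%:M - J *m J') *m c%:M.
  rewrite -p0; apply: nceval_intertwine => i.
  by rewrite mulmx0 mulmxBr mulmx1 mulmxA -[_ *m J]mulmxA J'J mulmx1 subrr.
rewrite -{1}[nceval Y p]mulmx1 -[in LHS](subrK (J *m J') 1%:M) mulmxDr YQ.
by rewrite mulmxA YJ addrC mul_mx_scalar.
Qed.

Lemma close_of_hat d r (P : 'I_r -> ncpoly F d) :
  exists C, forall n n' (X : 'I_d -> 'M[F]_n.+1) (B : 'I_d -> 'M[F]_n'.+1) h k,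
    (forall j, \rank (nceval X (P j)) <= k)%N ->
    (forall i, rank_hat_sub (X i) (B i) <= h)%N ->
    (forall j, nceval B (P j) = 0) ->
    exists w (B' : 'I_d -> 'M[F]_w.+1),
      (forall j, nceval B' (P j) = 0) /\ close (C * h + k) X B'.
Proof.
have [C HC] : exists C, forall j n (X X' : 'I_d -> 'M[F]_n.+1) h,
    (forall i, apx h (X i) (X' i)) ->
    apx (C * h) (nceval X (P j)) (nceval X' (P j)).
  apply: unif_bound => [j a b ab H n X X' h XX' | j].
    by apply: apx_le (H _ _ _ _ XX'); rewrite leq_mul2r ab orbT.
  have [C HC] := nceval_intertwine_apx (P j); exists C => n X X' h XX'.
  have := HC _ _ X X' 1%:M h; rewrite mulmx1 mul1mx; apply=> i.
  by rewrite mulmx1 mul1mx.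
exists (C + d.+1)%N => n n' X B h k XP XB B0.
have [nn'|n'n] := leqP n n'.
  have [w [B' [B'0 XB']]] := close_of_hat_le nn' XB.
  exists w, B'; split=> [j|]; first exact: B'0.
  by apply: close_le XB'; nia.
have [J [J' [_ J'J _ rh]]] := rank_hat_sub_intertwine F n.+1 n'.+1.
have {}J'J : J' *m J = 1%:M by apply: apx0_eq; apply: apx_le J'J; lia.
pose Y i := J *m B i *m J'.
have XY i : apx h (X i) (Y i).
  by apply: apx_le (XB i) _; have [] := rh (X i) (B i).
have /fin_all_exists[c Hc] := fun j => nceval_zero (P j).
have YP j : nceval Y (P j) = c j *: (1%:M - J *m J').
  by rewrite (nceval_dilate _ J'J (Hc j n)) B0 mulmx0 mul0mx add0r.
(* If all constant terms vanish, padding [B] by zeros keeps the relations exact. *)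
have [/forallP c0|] := boolP [forall j, c j == 0].
  exists n, Y; split=> [j|]; first by rewrite YP (eqP (c0 j)) scale0r.
  exists 1%:M, 1%:M; split=> [||i]; rewrite ?mulmx1 ?mul1mx ?apx_refl //.
  by apply: apx_le (XY i); nia.
(* Otherwise [P j] at the padded tuple [Y] is a nonzero multiple of [1 - J J']. As [Y] is near [X],
   this projection has rank at most [C * h + k], and [B] itself is close to [X]. *)
rewrite negb_forall => /existsP[j cj0].
exists n', B; split=> //; exists J, J'; split=> [||i].
- rewrite /apx -opprB mxrank_opp -(mxrank_scale_nz _ cj0) -YP.
  apply: leq_trans (apx_rank (apx_sym (HC j _ _ _ _ XY))) _.
  by have := XP j; nia.
- by rewrite J'J apx_refl.
- have [XJ _ _] := rh (X i) (B i); apply: apx_le XJ.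
  by apply: leq_trans (XB i) _; nia.
Qed.

End Closeness.

(** * Real epsilon and delta versus integer bounds *)

Section RealVersion.
Variables (R : realType) (F : fieldType) (d r : nat) (P : 'I_r -> ncpoly F d).

Lemma nat_stable_of_rank_stable : rank_stable_presentation R P -> nat_stable P.
Proof.
move=> stP e; have [C HC] := close_of_hat P.
(* Taking epsilon as [1/E] makes [2 * e * C * h <= n.+1]; the summand [2 * e] of the constant chosen
   below gives [2 * e * p <= n.+1]. Each is half of the budget. *)
pose E := (2 * e * C).+1.
have [|delta [delta0 Hdelta]] := stP (E%:R^-1); first by rewrite invr_gt0 ltr0n.
pose D0 := Num.Def.archi_bound delta^-1.
exists (2 * e + D0)%N => n X p XP Dp.
have [|n' [B [B0 XB]]] := Hdelta n X.
  move=> j; rewrite /rk ltr_pdivrMr ?ltr0n //.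
  apply: le_lt_trans (_ : p%:R < _); first by rewrite ler_nat.
  (* The strict inequality comes from [D0] exceeding [1/delta], multiplied by [p], so [p = 0] is
     separate. *)
  case: (posnP p) => [->|p0]; first by rewrite mulr_gt0 ?ltr0n.
  rewrite mulrC -ltr_pdivrMr //.
  apply: lt_le_trans (_ : D0%:R * p%:R <= _).
    rewrite mulrC ltr_pM2r ?ltr0n //; apply: archi_boundP.
    by rewrite invr_ge0 ltW.
  by rewrite -natrM ler_nat; apply: leq_trans Dp; rewrite leq_mul2r leq_addl orbT.
pose h := (n.+1 %/ E)%N.
have XBh i : (rank_hat_sub (X i) (B i) <= h)%N.
  rewrite leq_divRL // ltnW // -(ltr_nat R) natrM -ltr_pdivlMr ?ltr0n //.
  by rewrite mulrC.
have [w [B' [B'0 XB']]] := HC _ _ _ _ _ _ XP XBh B0.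
exists w, B', (C * h + p)%N; split=> //.
have hE : (h * E <= n.+1)%N := leq_divM _ _.
rewrite /E in hE; nia.
Qed.

Lemma rank_stable_of_nat_stable : nat_stable P -> rank_stable_presentation R P.
Proof.
move=> stP eps eps0; pose a := Num.Def.archi_bound eps^-1.
(* [9] is the loss in [close_rank_hat], and [a] exceeds [1/eps]. *)
have [D HD] := stP (9 * a)%N.
exists (D.+1%:R^-1); split=> [|n X XP]; first by rewrite invr_gt0 ltr0n.
have Dp : (D * (n.+1 %/ D.+1) <= n.+1)%N by have := leq_divM n.+1 D.+1; nia.
have [|n' [B [k [B0 /close_rank_hat[B' [B'P B'X]] ek]]]] := HD n X _ _ Dp.
  move=> j; rewrite leq_divRL // ltnW // -(ltr_nat R) natrM.
  by rewrite -ltr_pdivlMr ?ltr0n // mulrC -ltr_pdivrMr ?ltr0n //; apply: XP.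
exists n', B'; split=> [j|i]; first exact: B'P.
apply: le_lt_trans (_ : (9 * k)%:R < _); first by rewrite ler_nat.
case: (posnP k) => [->|k0]; first by rewrite muln0 mulr_gt0 ?ltr0n.
rewrite -ltr_pdivrMl //; apply: lt_le_trans (_ : (9 * a * k)%:R <= _).
  rewrite mulnAC mulrC [ltRHS]natrM ltr_pM2l ?ltr0n ?muln_gt0 //.
  by apply: archi_boundP; rewrite invr_ge0 ltW.
by rewrite ler_nat.
Qed.

End RealVersion.

(** * From the matrix algebra to A *)

Section NcevalMorphism.
Variable F : fieldType.

(** The laws of [f] are spelled out so that the lemma applies to plain functions such as [blk] and
    [mapphi]. *)
Lemma nceval_comp d (S S' : algType F) (f : S -> S') (a : 'I_d -> S) p :
  f 1 = 1 -> (forall c x y, f (c *: x + y) = c *: f x + f y) ->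
  (forall x y, f (x * y) = f x * f y) ->
  f (nceval a p) = nceval (fun i => f (a i)) p.
Proof.
move=> f1 fL fM.
have f0 : f 0 = 0 by rewrite -(addNr 0) -scaleN1r fL scaleN1r addNr.
elim/ncpoly_ind: p => [|| c p q IHp IHq | i p IH].
- by rewrite !rmorph0.
- by rewrite !rmorph1.
- by rewrite !linearP fL IHp IHq.
- by rewrite !rmorphM /= fM IH !nceval_var.
Qed.

Lemma lrmorphism_nceval d (S : algType F) (f : {lrmorphism ncpoly F d -> S}) p :
  f p = nceval (fun i => f (ncvar F i)) p.
Proof.
elim/ncpoly_ind: p => [|| c p q IHp IHq | i p IH].
- by rewrite !rmorph0.
- by rewrite !rmorph1.
- by rewrite !linearP /= IHp IHq.
- by rewrite !rmorphM /= nceval_var IH.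
Qed.

Lemma eq_nceval d (S : algType F) (a b : 'I_d -> S) p :
  (forall i, a i = b i) -> nceval a p = nceval b p.
Proof.
move=> ab; elim/ncpoly_ind: p => [|| c p q IHp IHq | i p IH].
- by rewrite !rmorph0.
- by rewrite !rmorph1.
- by rewrite !linearP /= IHp IHq.
- by rewrite !rmorphM /= !nceval_var ab IH.
Qed.

End NcevalMorphism.

Section Blocks.
Variable F : fieldType.

(** A direct sum decomposition into [m.+1] copies of one space. Working from these identities
    confines index arithmetic to [block_system_exists]. *)
Record block_system (m n N : nat) (iota : 'I_m.+1 -> 'M[F]_(N.+1, n.+1))
    (pi : 'I_m.+1 -> 'M[F]_(n.+1, N.+1)) : Prop := BlockSystem {
  block_proj_incl : forall j k, pi j *m iota k = (j == k)%:R%:M;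
  block_sum : \sum_j iota j *m pi j = 1%:M
}.

Lemma block_system_exists m n : exists N iota pi,
  (N.+1 = m.+1 * n.+1)%N /\ @block_system m n N iota pi.
Proof.
pose io (j : 'I_m.+1) : 'M[F]_(m.+1 * n.+1, n.+1) :=
  \matrix_(a, b) (a == mxvec_index j b)%:R.
have mxvI (j k : 'I_m.+1) (a b : 'I_n.+1) :
    (mxvec_index j a == mxvec_index k b) = (j == k) && (a == b).
  by rewrite (inj_eq (@cast_ord_inj _ _ _)) (inj_eq enum_rank_inj).
have io_orth j k : (io j)^T *m io k = (j == k)%:R%:M.
  apply/matrixP => a b; rewrite !mxE (bigD1 (mxvec_index j a)) //= big1.
    rewrite !mxE eqxx mul1r addr0 mxvI.
    by case: (j == k); case: (a == b).
  by move=> c /negPf nc; rewrite !mxE nc mul0r.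
suff io_sum : \sum_j io j *m (io j)^T = 1%:M.
  by exists (n + m * n.+1)%N, io, (fun j => (io j)^T).
apply/matrixP => a b; rewrite summxE !mxE.
case/mxvec_indexP: a => j a; case/mxvec_indexP: b => k b.
rewrite (bigD1 j) //= [X in _ + X]big1 => [|l nlj]; last first.
  rewrite mxE big1 // => c _; rewrite !mxE mxvI eq_sym (negPf nlj).
  by rewrite mul0r.
rewrite addr0 mxE (bigD1 a) //= big1 => [|c nca].
  by rewrite !mxE !mxvI !eqxx mul1r addr0 (eq_sym k) (eq_sym b).
by rewrite !mxE mxvI eqxx eq_sym (negPf nca) mul0r.
Qed.

Variables (m n N : nat) (iota : 'I_m.+1 -> 'M[F]_(N.+1, n.+1))
    (pi : 'I_m.+1 -> 'M[F]_(n.+1, N.+1)).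
Hypothesis io_pi : block_system iota pi.
Variables (d : nat) (X : 'I_d -> 'M[F]_n.+1).

(** The block matrix whose blocks are the entries of [G] evaluated at [X]. *)
Definition blk (G : matalg (ncalg F d) m) : 'M[F]_N.+1 :=
  \sum_j \sum_k iota j *m nceval X (G j k) *m pi k.

Lemma proj_blk j G : pi j *m blk G = \sum_k nceval X (G j k) *m pi k.
Proof.
rewrite /blk mulmx_sumr (bigD1 j) //= [X in _ + X]big1 => [|l nlj].
  rewrite addr0 mulmx_sumr; apply: eq_bigr => k _.
  by rewrite !mulmxA block_proj_incl // eqxx mul1mx.
rewrite mulmx_sumr big1 // => k _.
by rewrite !mulmxA block_proj_incl // eq_sym (negPf nlj) raddf0 !mul0mx.
Qed.

Lemma blk_ext (M M' : 'M[F]_N.+1) :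
  (forall j, pi j *m M = pi j *m M') -> M = M'.
Proof.
move=> MM'; rewrite -(mul1mx M) -(mul1mx M') -(block_sum io_pi) !mulmx_suml.
by apply: eq_bigr => j _; rewrite -!mulmxA MM'.
Qed.

Lemma blk1 : blk 1 = 1.
Proof.
apply: blk_ext => j; rewrite proj_blk (bigD1 j) //= [X in _ + X]big1 => [|k nkj].
  by rewrite mxE eqxx rmorph1 mul1mx mulmx1 addr0.
by rewrite mxE eq_sym (negPf nkj) rmorph0 mul0mx.
Qed.

Lemma blk_linear c G H : blk (c *: G + H) = c *: blk G + blk H.
Proof.
rewrite /blk scaler_sumr -big_split; apply: eq_bigr => j _.
rewrite scaler_sumr -big_split; apply: eq_bigr => k _ /=.
by rewrite !mxE linearP /= mulmxDr mulmxDl -scalemxAr -scalemxAl.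
Qed.

Lemma blkM G H : blk (G * H) = blk G * blk H.
Proof.
apply: blk_ext => j; rewrite -mulmxE mulmxA !proj_blk mulmx_suml.
rewrite [RHS](eq_bigr (fun k => \sum_l
  nceval X (G j k) *m nceval X (H k l) *m pi l)) => [|k _].
  rewrite exchange_big; apply: eq_bigr => l _; rewrite -mulmx_suml.
  rewrite mxE rmorph_sum; congr (_ *m _); apply: eq_bigr => k _.
  by rewrite rmorphM mulmxE.
rewrite -mulmxA proj_blk mulmx_sumr.
by apply: eq_bigr => l _; rewrite mulmxA.
Qed.

Lemma nceval_blk d' (g : 'I_d' -> matalg (ncalg F d) m) q :
  nceval (fun i => blk (g i)) q = blk (nceval g q).
Proof. by rewrite -(nceval_comp g q blk1 blk_linear blkM). Qed.

Lemma proj_blk_scalar j p :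
  pi j *m blk (\matrix_(a, b) (p *+ (a == b))) = nceval X p *m pi j.
Proof.
rewrite proj_blk (bigD1 j) //= [X in _ + X]big1 => [|k nkj].
  by rewrite mxE eqxx addr0.
by rewrite mxE eq_sym (negPf nkj) rmorph0 mul0mx.
Qed.

Lemma blk_delta j k : blk (delta_mx j k) = iota j *m pi k.
Proof.
apply: blk_ext => l; rewrite proj_blk mulmxA block_proj_incl //.
rewrite (bigD1 k) //= [X in _ + X]big1 => [|i nik].
  rewrite mxE eqxx andbT addr0.
  by case: (l == j); rewrite ?rmorph1 ?rmorph0 ?raddf0 ?mul0mx ?mul1mx.
by rewrite mxE (negPf nik) andbF rmorph0 mul0mx.
Qed.

Lemma apx_blk k (G H : matalg (ncalg F d) m) :
  (forall i j, \rank (nceval X (G i j - H i j)) <= k)%N ->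
  apx (m.+1 * (m.+1 * k)) (blk G) (blk H).
Proof.
move=> GH; have apxGH i j : apx k (nceval X (G i j)) (nceval X (H i j)).
  by rewrite /apx -rmorphB; exact: GH.
have := @apx_sum F 'I_m.+1 (m.+1 * k) N.+1 N.+1
  (fun i => \sum_j iota i *m nceval X (G i j) *m pi j)
  (fun i => \sum_j iota i *m nceval X (H i j) *m pi j).
rewrite card_ord; apply => i.
rewrite -{1}[m.+1]card_ord; apply: apx_sum => j.
exact/apx_mulr/apx_mull.
Qed.

End Blocks.

Section MatrixUnits.
Variables (F : fieldType) (A : algType F) (m : nat).

Lemma matalg_deltaM (i j k l : 'I_m.+1) :
  (delta_mx i j : matalg A m) * delta_mx k l = delta_mx i l *+ (j == k).
Proof. exact: mul_delta_mx_cond. Qed.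

Lemma matalg_sum_delta : \sum_i (delta_mx i i : matalg A m) = 1.
Proof. exact: esym (mx1_sum_delta A m.+1). Qed.

(** Scalar matrices need not be central when [A] is noncommutative, but the entries of a matrix unit
    are 0 and 1. *)
Lemma matalg_delta_scalar (i j : 'I_m.+1) (a : A) :
  (delta_mx i j : matalg A m) * a%:M = a%:M * delta_mx i j.
Proof.
have -> : a%:M = diag_mx (const_mx a) :> matalg A m by rewrite diag_const_mx.
rewrite [LHS](mul_mx_diag (delta_mx i j)) [RHS](mul_diag_mx _ (delta_mx i j)).
apply/matrixP => k l; rewrite !mxE.
by case: (_ && _); rewrite ?mulr1 ?mul1r ?mulr0 ?mul0r.
Qed.

Lemma scalar_nceval d (a : 'I_d -> A) p :
  nceval (fun i => (a i)%:M : matalg A m) p = (nceval a p)%:M.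
Proof.
have f1 : (1 : A)%:M = 1 :> matalg A m by [].
rewrite -(@nceval_comp _ _ _ (matalg A m) (fun x => x%:M)) //.
  move=> c x y; apply/matrixP=> i j; rewrite !mxE.
  by case: (i == j); rewrite // !mulr0n scaler0 addr0.
by move=> x y; exact: scalar_mxM.
Qed.

End MatrixUnits.

Section FromMatrixAlgebra.
Variables (F : fieldType) (A : algType F) (m : nat).
Variables (d r : nat) (P : 'I_r -> ncpoly F d) (phi : {lrmorphism ncpoly F d -> A}).
Hypothesis kerphi : forall q, phi q = 0 -> in_ideal P q.

Definition mapphi (G : matalg (ncalg F d) m) : matalg A m :=
  \matrix_(i, j) phi (G i j).

Lemma mapphi1 : mapphi 1 = 1.
Proof.
by apply/matrixP => i j; rewrite !mxE; case: (i == j); rewrite ?rmorph1 ?rmorph0.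
Qed.

Lemma mapphi_linear c G H : mapphi (c *: G + H) = c *: mapphi G + mapphi H.
Proof.
apply/matrixP => i j; rewrite !mxE.
exact: (linearP phi).
Qed.

Lemma mapphiM G H : mapphi (G * H) = mapphi G * mapphi H.
Proof.
apply/matrixP => i j; rewrite !mxE rmorph_sum; apply: eq_bigr => k _.
by rewrite !mxE; exact: (rmorphM phi).
Qed.

(** The entries of [G - H] lie in the ideal of [P], so they have small rank at [X]. Exact identities
    in the matrix algebra thus become approximate ones between block matrices. *)
Lemma apx_blk_mapphi (G H : matalg (ncalg F d) m) : mapphi G = mapphi H ->
  exists C, forall n N (iota : 'I_m.+1 -> 'M[F]_(N.+1, n.+1))
      (pi : 'I_m.+1 -> 'M_(n.+1, N.+1)) (X : 'I_d -> 'M_n.+1) k,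
    (forall j, \rank (nceval X (P j)) <= k)%N ->
    apx (C * k) (blk iota pi X G) (blk iota pi X H).
Proof.
move=> GH.
have [C HC] : exists C, forall (ij : 'I_m.+1 * 'I_m.+1) n (X : 'I_d -> 'M_n.+1) k,
    (forall j, \rank (nceval X (P j)) <= k)%N ->
    (\rank (nceval X (G ij.1 ij.2 - H ij.1 ij.2)) <= C * k)%N.
  apply: unif_bound => [ij a b ab HC n X k Pk | [i j]].
    by apply: leq_trans (HC _ _ _ Pk) _; rewrite leq_mul2r ab orbT.
  apply: rank_nceval_ideal; apply: kerphi.
  have /matrixP/(_ i j) := GH; rewrite !mxE => GHij.
  by rewrite -[RHS](subrr (phi (H i j))) -{1}GHij; exact: (rmorphB phi).
exists (m.+1 * (m.+1 * C))%N => n N iota pi X k Pk.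
rewrite -!mulnA; apply: apx_blk => i j.
exact: (HC (i, j)).
Qed.

Variables (d' r' : nat) (Q : 'I_r' -> ncpoly F d').
Variable psi : {lrmorphism ncpoly F d' -> matalg A m}.
Hypothesis phi_surj : forall a, exists q, phi q = a.
Hypothesis phiP : forall j, phi (P j) = 0.
Hypothesis psi_surj : forall a, exists q, psi q = a.
Hypothesis kerpsi : forall q, psi q = 0 <-> in_ideal Q q.

(** An exact solution of [Q] represents the matrix algebra, so identities can be verified there and
    transported. *)
Lemma nceval_eq (S : algType F) (b : 'I_d' -> S) q q' :
  (forall j, nceval b (Q j) = 0) -> psi q = psi q' -> nceval b q = nceval b q'.
Proof.
move=> bQ qq'; apply/eqP; rewrite -subr_eq0 -rmorphB; apply/eqP.
by apply: nceval_ideal bQ _; apply/kerpsi; rewrite rmorphB /= qq' subrr.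
Qed.

Lemma nat_stable_of_matalg : nat_stable Q -> nat_stable P.
Proof.
move=> stQ e.
(* [g] lifts the generators of the matrix algebra to matrices over the free algebra; their blocks at
   [X] form the tuple [Y]. *)
have /fin_all_exists[g mapg] : forall i, exists G, mapphi G = psi (ncvar F i).
  move=> i.
  have [f Hf] := fin_all_exists (fun jk : 'I_m.+1 * 'I_m.+1 =>
    phi_surj (psi (ncvar F i) jk.1 jk.2)).
  exists (\matrix_(j, k) f (j, k)); apply/matrixP=> j k.
  by rewrite !mxE Hf.
have mapphi_g q : mapphi (nceval g q) = psi q.
  rewrite (nceval_comp g q mapphi1 mapphi_linear mapphiM).
  by rewrite [RHS]lrmorphism_nceval; apply: eq_nceval.
have phiE p : phi p = nceval (fun i => phi (ncvar F i)) p.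
  exact: lrmorphism_nceval.
have psiE p : psi p = nceval (fun i => psi (ncvar F i)) p.
  exact: lrmorphism_nceval.
(* [u] stands for the corner matrix unit, and [h i] below for the scalar matrix of the i-th
   generator of [A]. *)
have [u psiu] := psi_surj (delta_mx ord0 ord0).
have /fin_all_exists[h psih] : forall i, exists q, psi q = (phi (ncvar F i))%:M.
  by move=> i; apply: psi_surj.
have [Cu HCu] : exists C, forall n N (iota : 'I_m.+1 -> 'M[F]_(N.+1, n.+1))
    (pi : 'I_m.+1 -> 'M_(n.+1, N.+1)) (X : 'I_d -> 'M_n.+1) k,
    (forall j, \rank (nceval X (P j)) <= k)%N ->
    apx (C * k) (blk iota pi X (nceval g u))
      (blk iota pi X (delta_mx ord0 ord0)).
  apply: apx_blk_mapphi; rewrite mapphi_g psiu.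
  by apply/matrixP => i j; rewrite !mxE rmorph_nat.
have [Ch HCh] : exists C, forall i n N (iota : 'I_m.+1 -> 'M[F]_(N.+1, n.+1))
    (pi : 'I_m.+1 -> 'M_(n.+1, N.+1)) (X : 'I_d -> 'M_n.+1) k,
    (forall j, \rank (nceval X (P j)) <= k)%N ->
    apx (C * k) (blk iota pi X (nceval g (h i)))
      (blk iota pi X (\matrix_(a, b) (ncvar F i *+ (a == b)))).
  apply: unif_bound => [i a b ab HC n N io pi X k Pk | i].
    by apply: apx_le (HC _ _ _ _ _ _ Pk); rewrite leq_mul2r ab orbT.
  apply: apx_blk_mapphi; rewrite mapphi_g psih.
  by apply/matrixP => a b; rewrite !mxE; case: (a == b); rewrite // rmorph0.
have [CQ HCQ] : exists C, forall l n N (iota : 'I_m.+1 -> 'M[F]_(N.+1, n.+1))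
    (pi : 'I_m.+1 -> 'M_(n.+1, N.+1)) (X : 'I_d -> 'M_n.+1) k,
    (forall j, \rank (nceval X (P j)) <= k)%N ->
    apx (C * k) (blk iota pi X (nceval g (Q l))) (blk iota pi X 0).
  apply: unif_bound => [i a b ab HC n N io pi X k Pk | l].
    by apply: apx_le (HC _ _ _ _ _ _ Pk); rewrite leq_mul2r ab orbT.
  apply: apx_blk_mapphi; rewrite mapphi_g.
  have -> : psi (Q l) = 0.
    apply/kerpsi; exists [:: (1, l, 1)].
    by rewrite big_seq1 mul1r mulr1.
  by apply/matrixP => i j; rewrite !mxE rmorph0.
have [cu Hcu] := nceval_intertwine_apx u.
have [ch Hch] : exists C, forall i n n' (Y : 'I_d' -> 'M[F]_n.+1)
    (B : 'I_d' -> 'M[F]_n'.+1) (S : 'M[F]_(n.+1, n'.+1)) k,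
    (forall i, apx k (Y i *m S) (S *m B i)) ->
    apx (C * k) (nceval Y (h i) *m S) (S *m nceval B (h i)).
  apply: unif_bound => [i a b ab HC n n' Y B S k YS | i].
    by apply: apx_le (HC _ _ _ _ _ _ YS); rewrite leq_mul2r ab orbT.
  exact: nceval_intertwine_apx.
pose c := (ch + cu).+1; pose C := (Ch + Cu)%N.
(* The factor [m.+1] compensates for [N.+1] being [m.+1 * n.+1]; each factor 2 reserves half of the
   budget, for [c * k] and for [C * p]. *)
have [D HD] := stQ (2 * e * c * m.+1)%N.
exists (D * CQ + 2 * e * C)%N => n X p XP Dp.
have [N [iota [pi [NE sys]]]] := block_system_exists F m n.
pose Y i := blk iota pi X (g i).
have YE q : nceval Y q = blk iota pi X (nceval g q) by apply: nceval_blk.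
have blk0 : blk iota pi X 0 = 0.
  by have := nceval_blk sys X g 0; rewrite !rmorph0.
have YQ l : (\rank (nceval Y (Q l)) <= CQ * p)%N.
  by rewrite -apx0 -blk0 YE; apply: HCQ.
have [|N' [B [k [BQ [S [T [ST TS YS]]] ek]]]] := HD N Y (CQ * p)%N YQ.
  rewrite NE; nia.
have rho q q' := @nceval_eq _ B q q' BQ.
pose E := nceval B u.
have EE : E *m E = E.
  rewrite mulmxE -rmorphM; apply: rho.
  by rewrite rmorphM /= !psiu matalg_deltaM eqxx.
have Eh i : E *m nceval B (h i) = nceval B (h i) *m E.
  rewrite !mulmxE -!rmorphM; apply: rho.
  by rewrite !rmorphM /= psiu psih matalg_delta_scalar.
(* The corner unit generates the whole matrix algebra as an ideal, so [E = 0] would give [1 = 0]. *)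
have E0 : E != 0.
  apply/eqP => E0.
  have /fin_all_exists[v Hv] := fun j => psi_surj (delta_mx j ord0).
  have /fin_all_exists[v' Hv'] := fun j => psi_surj (delta_mx ord0 j).
  have: nceval B 1 = nceval B (\sum_j v j * u * v' j).
    apply: rho; rewrite rmorph1 rmorph_sum -matalg_sum_delta.
    apply: eq_bigr => j _.
    by rewrite !rmorphM /= Hv psiu Hv' !matalg_deltaM eqxx.
  rewrite rmorph1 rmorph_sum big1 => [|j _]; last first.
    by rewrite !rmorphM /= -/E E0 mulr0 mul0r.
  by apply/eqP; rewrite oner_eq0.
have [w [R [K [R' [K' [KR RR' K'K rankE]]]]]] := rank_factor E0.
(* Cancel the outer factors in [E *m E = E]. *)
have RK : R *m K = 1%:M.
  have: K' *m (E *m E) *m R' = K' *m E *m R' by rewrite EE.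
  rewrite -KR !mulmxA K'K mul1mx -!mulmxA RR' !mulmx1 => ->.
  by [].
have EK : E *m K = K by rewrite -KR -mulmxA RK mulmx1.
have RE : R *m E = R by rewrite -KR mulmxA RK mul1mx.
pose B' i := R *m nceval B (h i) *m K.
have B'R i : B' i *m R = R *m nceval B (h i).
  by rewrite /B' -[LHS]mulmxA KR -mulmxA -Eh mulmxA RE.
exists w, B', (c * k + C * p)%N; split; last by rewrite /c /C; nia.
  (* After multiplication by [R] this is [R] times the value at [B] of [P j] with [h] substituted, a
     polynomial that [psi] sends to the scalar matrix of [phi (P j) = 0]. *)
  move=> j; suff: nceval B' (P j) *m R = 0.
    by move=> /(congr1 (mulmxr R')); rewrite /= -mulmxA RR' mulmx1 mul0mx.
  rewrite (nceval_intertwine (P j) B'R) -nceval_subst.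
  rewrite (rho _ 0) ?rmorph0 ?mulmx0 //.
  have -> : psi (ncsubst h (P j)) = (phi (P j))%:M.
    rewrite psiE nceval_subst phiE -scalar_nceval; apply: eq_nceval => i.
    by rewrite -psiE psih.
  by rewrite phiP raddf0.
pose io := iota ord0; pose pj := pi ord0.
have pjio : pj *m io = 1%:M by rewrite /pj /io (block_proj_incl sys) eqxx.
have u_apx : apx (Cu * p) (nceval Y u) (io *m pj).
  by rewrite YE -(blk_delta sys X); apply: HCu.
have uS : apx (cu * k) (nceval Y u *m S) (S *m E) := Hcu _ _ _ _ _ _ YS.
have h_apx i : apx (Ch * p) (pj *m nceval Y (h i)) (X i *m pj).
  rewrite -(nceval_var X) -(proj_blk_scalar sys) YE.
  exact/apx_mull/HCh.
have hS i := Hch i _ _ _ _ _ _ YS.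
move: io pj pjio u_apx h_apx {sys NE YE YQ} => io pj pjio u_apx h_apx.
(* Enter the first block, cross over by [S], then cut down to the image of [E]; the way back uses
   [T]. *)
exists (pj *m S *m K), (R *m T *m io); split=> [||i].
- apply: (@apx_le _ (cu * k + (k + Cu * p))); first by rewrite /c /C; nia.
  have -> : pj *m S *m K *m (R *m T *m io) = pj *m (S *m E) *m (T *m io).
    by rewrite -KR !mulmxA.
  apply: apx_trans (apx_mulr _ (apx_mull _ (apx_sym uS))) _.
  have -> : pj *m (nceval Y u *m S) *m (T *m io) =
      pj *m nceval Y u *m (S *m T) *m io by rewrite !mulmxA.
  apply: apx_trans (apx_mulr _ (apx_mull _ ST)) _; rewrite mulmx1.
  have -> : 1%:M = pj *m (io *m pj) *m io.
    by rewrite mulmxA pjio mul1mx pjio.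
  exact/apx_mulr/apx_mull.
- apply: (@apx_le _ (Cu * p + (cu * k + k))); first by rewrite /c /C; nia.
  have -> : R *m T *m io *m (pj *m S *m K) = R *m T *m (io *m pj) *m (S *m K).
    by rewrite !mulmxA.
  apply: apx_trans (apx_mulr _ (apx_mull _ (apx_sym u_apx))) _.
  have -> : R *m T *m nceval Y u *m (S *m K) = R *m T *m (nceval Y u *m S) *m K.
    by rewrite !mulmxA.
  apply: apx_trans (apx_mulr _ (apx_mull _ uS)) _.
  have -> : R *m T *m (S *m E) *m K = R *m (T *m S) *m K.
    by rewrite -[in RHS]EK !mulmxA.
  have -> : 1%:M = R *m 1%:M *m K by rewrite mulmx1 RK.
  exact/apx_mulr/apx_mull.
- apply: (@apx_le _ (Ch * p + ch * k)); first by rewrite /c /C; nia.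
  have -> : X i *m (pj *m S *m K) = X i *m pj *m (S *m K) by rewrite !mulmxA.
  apply: apx_trans (apx_mulr _ (apx_sym (h_apx i))) _.
  have -> : pj *m nceval Y (h i) *m (S *m K) = pj *m (nceval Y (h i) *m S) *m K.
    by rewrite !mulmxA.
  have -> : pj *m S *m K *m B' i = pj *m (S *m nceval B (h i)) *m K.
    rewrite /B' -(mulmxA R) -[in RHS]EK.
    have -> : pj *m (S *m nceval B (h i)) *m (E *m K) =
      pj *m S *m (nceval B (h i) *m E) *m K by rewrite !mulmxA.
    by rewrite -Eh -KR !mulmxA.
  exact/apx_mulr/apx_mull.
Qed.

End FromMatrixAlgebra.

(** * A presentation of the matrix algebra *)

Section IdealClosure.
Variables (F : fieldType) (d r : nat) (P : 'I_r -> ncpoly F d).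

Lemma in_ideal_gen j : in_ideal P (P j).
Proof. by exists [:: (1, j, 1)]; rewrite big_seq1 mul1r mulr1. Qed.

Lemma in_ideal0 : in_ideal P 0.
Proof. by exists [::]; rewrite big_nil. Qed.

Lemma in_idealD p q : in_ideal P p -> in_ideal P q -> in_ideal P (p + q).
Proof. by move=> [s ->] [t ->]; exists (s ++ t); rewrite big_cat. Qed.

Lemma in_idealMl a p : in_ideal P p -> in_ideal P (a * p).
Proof.
move=> [s ->]; exists [seq (a * t.1.1, t.1.2, t.2) | t <- s].
by rewrite big_map mulr_sumr; apply: eq_bigr => t _; rewrite mulrA [a * _]mulrA.
Qed.

Lemma in_idealMr a p : in_ideal P p -> in_ideal P (p * a).
Proof.
move=> [s ->]; exists [seq (t.1.1, t.1.2, t.2 * a) | t <- s].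
by rewrite big_map mulr_suml; apply: eq_bigr => t _; exact: esym (mulrA _ _ _).
Qed.

Lemma in_idealZ c p : in_ideal P p -> in_ideal P (c *: p).
Proof. by rewrite -mul_malgC; apply: in_idealMl. Qed.

Lemma in_idealN p : in_ideal P p -> in_ideal P (- p).
Proof. by rewrite -scaleN1r; apply: in_idealZ. Qed.

Lemma in_ideal_sym p q : in_ideal P (p - q) -> in_ideal P (q - p).
Proof. by move=> /in_idealN; rewrite opprB. Qed.

Lemma in_ideal_trans q p s :
  in_ideal P (p - q) -> in_ideal P (q - s) -> in_ideal P (p - s).
Proof. by move=> pq /(in_idealD pq); rewrite subrKA. Qed.

Lemma in_ideal_subMl a p q :
  in_ideal P (p - q) -> in_ideal P (a * p - a * q).
Proof. by move=> /(in_idealMl a); rewrite mulrBr. Qed.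

Lemma in_ideal_subMr a p q :
  in_ideal P (p - q) -> in_ideal P (p * a - q * a).
Proof. by move=> /(in_idealMr a); rewrite mulrBl. Qed.

Lemma in_ideal_commM a p q : in_ideal P (a * p - p * a) ->
  in_ideal P (a * q - q * a) -> in_ideal P (a * (p * q) - p * q * a).
Proof.
move=> ap aq.
apply: (eq_ind_r (in_ideal P) _ (commMr a p q)).
by apply: in_idealD; [apply: in_idealMr; exact: ap | apply: in_idealMl; exact: aq].
Qed.

Lemma in_ideal_sum (I : finType) (f : I -> ncpoly F d) :
  (forall i, in_ideal P (f i)) -> in_ideal P (\sum_i f i).
Proof.
move=> Pf; elim/big_rec: _ => [|i p _]; first exact: in_ideal0.
exact: in_idealD.
Qed.

End IdealClosure.

Lemma in_ideal_subst (F : fieldType) d r (P : 'I_r -> ncpoly F d) d' r'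
    (P' : 'I_r' -> ncpoly F d') (h : 'I_d -> ncpoly F d') q :
  (forall j, in_ideal P' (ncsubst h (P j))) ->
  in_ideal P q -> in_ideal P' (ncsubst h q).
Proof.
move=> hP [s ->]; rewrite rmorph_sum; elim: s => [|t s [u IH]].
  by exists [::]; rewrite !big_nil.
have [v Hv] := in_idealMr (ncsubst h t.2) (in_idealMl (ncsubst h t.1.1) (hP t.1.2)).
exists (v ++ u); rewrite big_cons big_cat -IH -Hv.
have subM p q1 : ncsubst h (p * q1) = ncsubst h p * ncsubst h q1 by exact: rmorphM.
by congr (_ + _); rewrite /= subM subM.
Qed.

Section MatrixPresentation.
Variables (F : fieldType) (m d r : nat) (P : 'I_r -> ncpoly F d).
Local Notation idx := 'I_m.+1.
Local Notation gen_type := ('I_d + idx * idx)%type.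
Local Notation rel_type :=
  ('I_r + 'I_d * (idx * idx) + (idx * idx) * (idx * idx) + unit)%type.

(* Finite types are enumerated through abstract bijections, so that unification
   never has to compare cardinals. *)
Variables (D D' : nat) (enc : gen_type -> 'I_D) (dec : 'I_D -> gen_type).
Variables (encr : rel_type -> 'I_D') (decr : 'I_D' -> rel_type).
Hypotheses (encK : cancel enc dec) (decK : cancel dec enc).
Hypothesis encrK : cancel encr decr.

Definition mxgen (S : Type) (x : 'I_d -> S) (e : idx -> idx -> S)
    (t : 'I_D) : S :=
  match dec t with inl i => x i | inr jk => e jk.1 jk.2 end.

Definition coefvar (i : 'I_d) : ncpoly F D :=
  ncvar F (enc (inl i)).
Definition unitvar (j k : idx) : ncpoly F D :=
  ncvar F (enc (inr (j, k))).

(** The quotient is the tensor product of the algebra presented by [P] with the matrix algebra over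
    [F]. *)
Definition mxrel (t : rel_type) : ncpoly F D :=
  match t with
  | inl (inl (inl j)) => ncsubst coefvar (P j)
  | inl (inl (inr (i, (a, b)))) =>
      coefvar i * unitvar a b - unitvar a b * coefvar i
  | inl (inr ((a, b), (c, e))) =>
      unitvar a b * unitvar c e - unitvar a e *+ (b == c)
  | inr tt => \sum_a unitvar a a - 1
  end.

Definition mxpres (t : 'I_D') := mxrel (decr t).

Lemma mxpres_rank t : mxpres (encr t) = mxrel t.
Proof. by rewrite /mxpres encrK. Qed.

Lemma in_ideal_mxrel t : in_ideal mxpres (mxrel t).
Proof. by rewrite -mxpres_rank; apply: in_ideal_gen. Qed.

Section Eval.
Variables (S : algType F) (z : 'I_D -> S).
Let x i := z (enc (inl i)).
Let e j k := z (enc (inr (j, k))).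

Lemma nceval_mxrel t : nceval z (mxrel t) =
  match t with
  | inl (inl (inl j)) => nceval x (P j)
  | inl (inl (inr (i, (a, b)))) => x i * e a b - e a b * x i
  | inl (inr ((a, b), (c, l))) => e a b * e c l - e a l *+ (b == c)
  | inr tt => \sum_a e a a - 1
  end.
Proof.
case: t => [[[j|[i [a b]]]|[[a b] [c l]]]|[]] /=.
- by rewrite nceval_subst; apply: eq_nceval => i; rewrite nceval_var.
- have nM p q : nceval z (p * q) = nceval z p * nceval z q by exact: rmorphM.
  by rewrite rmorphB /=; congr (_ - _); rewrite nM !nceval_var.
- by rewrite rmorphB rmorphM rmorphMn /= !nceval_var.
- rewrite rmorphB rmorph1 rmorph_sum; congr (_ - _).
  by apply: eq_bigr => a _; exact: nceval_var.
Qed.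

Lemma nceval_coef p : nceval z (ncsubst coefvar p) = nceval x p.
Proof. by rewrite nceval_subst; apply: eq_nceval => i; exact: nceval_var. Qed.

End Eval.

Lemma mxgen_coef S (x : 'I_d -> S) e i : mxgen x e (enc (inl i)) = x i.
Proof. by rewrite /mxgen encK. Qed.

Lemma mxgen_unit S (x : 'I_d -> S) e j k :
  mxgen x e (enc (inr (j, k))) = e j k.
Proof. by rewrite /mxgen encK. Qed.

Local Notation eqI p q := (in_ideal mxpres (p - q)).

Lemma unitvar_coef a b p :
  eqI (unitvar a b * ncsubst coefvar p) (ncsubst coefvar p * unitvar a b).
Proof.
elim/ncpoly_ind: p => [|| c p q IHp IHq | i p IH].
- by rewrite rmorph0 mulr0 mul0r subrr; apply: in_ideal0.
- by rewrite rmorph1 mulr1 mul1r subrr; apply: in_ideal0.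
- rewrite linearP /= mulrDl mulrDr -scalerAl -ncpoly_scaleAr.
  rewrite opprD addrACA -scalerBr.
  by apply: in_idealD; [apply: in_idealZ; exact: IHp | exact: IHq].
- have -> : ncsubst coefvar (ncvar F i * p) = coefvar i * ncsubst coefvar p.
    by rewrite rmorphM /= ncsubst_var.
  apply: in_ideal_commM IH; apply: in_ideal_sym.
  exact: (in_ideal_mxrel (inl (inl (inr (i, (a, b)))))).
Qed.

(** Normal form modulo the relations: coefficients to the left of matrix units. *)
Definition mxform (G : idx -> idx -> ncpoly F d) :=
  \sum_j \sum_k ncsubst coefvar (G j k) * unitvar j k.

Lemma unitvar_mxform a b G :
  eqI (unitvar a b * mxform G) (mxform (fun j k => G b k *+ (j == a))).
Proof.
have -> : mxform (fun j k => G b k *+ (j == a)) =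
    \sum_k ncsubst coefvar (G b k) * unitvar a k.
  rewrite -(sum_mulrb a (fun j => \sum_k ncsubst coefvar (G b k) * unitvar j k)).
  apply: eq_bigr => j _; rewrite -sumrMnl; apply: eq_bigr => k _.
  by rewrite rmorphMn mulrnAl.
rewrite -(sum_mulrb b (fun j => \sum_k ncsubst coefvar (G j k) * unitvar a k)).
rewrite /mxform mulr_sumr -sumrB; apply: in_ideal_sum => j.
rewrite mulr_sumr -sumrMnl -sumrB; apply: in_ideal_sum => k.
rewrite eq_sym -mulrnAr.
apply: (@in_ideal_trans _ _ _ _
  (ncsubst coefvar (G j k) * unitvar a b * unitvar j k)).
  by rewrite [unitvar a b * _]mulrA; apply/in_ideal_subMr/unitvar_coef.
rewrite -(mulrA _ (unitvar a b)); apply: in_ideal_subMl.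
exact: (in_ideal_mxrel (inl (inr ((a, b), (j, k))))).
Qed.

(** Modulo the relations, normal forms contain 1 and are stable under linear combinations and left
    multiplication by generators. *)
Lemma mxform_exists q : exists G, eqI q (mxform G).
Proof.
elim/ncpoly_ind: q => [|| c p q [G HG] [H HH] | t p [G HG]].
- exists (fun _ _ => 0); rewrite /mxform big1 => [|j _].
    by rewrite subrr; apply: in_ideal0.
  by rewrite big1 // => k _; rewrite rmorph0 mul0r.
- exists (fun j k => (j == k)%:R); rewrite -opprB; apply: in_idealN.
  suff -> : mxform (fun j k => (j == k)%:R) = \sum_j unitvar j j.
    exact: (in_ideal_mxrel (inr tt)).
  apply: eq_bigr => j _; rewrite (bigD1 j) //= big1 => [|k nkj].
    by rewrite eqxx rmorph1 mul1r addr0.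
  by rewrite eq_sym (negPf nkj) rmorph0 mul0r.
- exists (fun j k => c *: G j k + H j k).
  have -> : mxform (fun j k => c *: G j k + H j k) = c *: mxform G + mxform H.
    rewrite /mxform scaler_sumr -big_split; apply: eq_bigr => j _.
    rewrite scaler_sumr -big_split; apply: eq_bigr => k _ /=.
    by rewrite linearP mulrDl -scalerAl.
  rewrite opprD addrACA -scalerBr; apply: in_idealD; last exact: HH.
  by apply: in_idealZ; exact: HG.
- rewrite -(decK t); case: (dec t) => [i|[a b]].
    exists (fun j k => ncvar F i * G j k).
    have -> : mxform (fun j k => ncvar F i * G j k) = coefvar i * mxform G.
      rewrite /mxform mulr_sumr; apply: eq_bigr => j _.
      rewrite mulr_sumr; apply: eq_bigr => k _.
      by rewrite rmorphM /= ncsubst_var mulrA.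
    exact: in_ideal_subMl.
  exists (fun j k => G b k *+ (j == a)).
  apply: (@in_ideal_trans _ _ _ _ (unitvar a b * mxform G)).
    exact: in_ideal_subMl.
  exact: unitvar_mxform.
Qed.

Variables (A : algType F).

(** A normal form evaluates to the matrix of images of its coefficients, which gives surjectivity.
    If that matrix is zero, all coefficients lie in the ideal of [P], hence the normal form lies in
    the ideal of [mxpres]. *)
Lemma presents_matalg : presents P A -> presents mxpres (matalg A m).
Proof.
case=> phi [phi_surj kerphi].
pose z := mxgen (fun i => (phi (ncvar F i))%:M : matalg A m)
  (fun j k => delta_mx j k).
have zc p : nceval z (ncsubst coefvar p) = (phi p)%:M.
  rewrite nceval_coef (lrmorphism_nceval phi) -scalar_nceval.
  by apply: eq_nceval => i; rewrite /z mxgen_coef.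
have zu j k : nceval z (unitvar j k) = delta_mx j k.
  by rewrite nceval_var /z mxgen_unit.
have zform G : nceval z (mxform G) = \matrix_(j, k) phi (G j k).
  rewrite [RHS]matrix_sum_delta rmorph_sum; apply: eq_bigr => j _.
  rewrite rmorph_sum; apply: eq_bigr => k _.
  by rewrite mxE rmorphM /= zc zu [LHS]mul_scalar_mx.
have zrel t : nceval z (mxpres t) = 0.
  rewrite /mxpres nceval_mxrel.
  case: (decr t) => [[[j|[i [a b]]]|[[a b] [c l]]]|[]].
  - rewrite -nceval_coef zc; have [_ ->] := kerphi (P j); first by rewrite raddf0.
    exact: in_ideal_gen.
  - by rewrite /z mxgen_coef mxgen_unit matalg_delta_scalar subrr.
  - by rewrite /z !mxgen_unit matalg_deltaM subrr.
  - under eq_bigr do rewrite /z mxgen_unit.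
    by rewrite matalg_sum_delta subrr.
exists (nceval z); split=> [M | q].
  have /fin_all_exists[f Hf] := fun jk : idx * idx => phi_surj (M jk.1 jk.2).
  exists (mxform (fun j k => f (j, k))); rewrite /= zform.
  by apply/matrixP => j k; rewrite mxE Hf.
split=> [q0|]; last exact: nceval_ideal.
have [G qG] := mxform_exists q.
have G0 j k : in_ideal P (G j k).
  apply/kerphi; have := zform G; have := nceval_ideal zrel qG.
  rewrite rmorphB /= q0 => /eqP; rewrite subr_eq0 => /eqP <-.
  by move=> /matrixP/(_ j k); rewrite !mxE.
rewrite -(subrK (mxform G) q); apply: in_idealD; first exact: qG.
apply: in_ideal_sum => j; apply: in_ideal_sum => k; apply: in_idealMr.
apply: in_ideal_subst (G0 j k) => l.
exact: (in_ideal_mxrel (inl (inl (inl l)))).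
Qed.

End MatrixPresentation.

(** * From A to its matrix algebra *)

Section ToMatrixAlgebra.
Variable F : fieldType.

Section ApproxMatrixUnits.
Variables (m n d : nat) (x : 'I_d -> 'M[F]_n.+1).
Variables (E : 'I_m.+1 -> 'I_m.+1 -> 'M[F]_n.+1) (p : nat).
Hypothesis xE : forall i a b, apx p (x i *m E a b) (E a b *m x i).
Hypothesis EE : forall a b c l, apx p (E a b *m E c l) (E a l *+ (b == c)).
Hypothesis E1 : apx p (\sum_a E a a) 1%:M.
Let E00 := E ord0 ord0.

Lemma apx_mxunit_split a : apx (p + p) (E a ord0 *m E00 *m E ord0 a) (E a a).
Proof.
have := EE a ord0 ord0 ord0; rewrite eqxx => /(apx_mulr (E ord0 a)) H.
by apply: apx_trans H _; have := EE a ord0 ord0 a; rewrite eqxx.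
Qed.

(** The identity is near a sum of [m.+1] matrices that factor through [E00]. *)
Lemma size_le_rank_mxunit :
  (n.+1 <= m.+1 * \rank E00 + (m.+1 * (p + p) + p))%N.
Proof.
have H := apx_sum_ord apx_mxunit_split.
have := apx_rank (apx_sym (apx_trans H E1)).
rewrite mxrank1 => /leq_trans; apply; rewrite leq_add2r.
apply: leq_trans (_ : \sum_(a : 'I_m.+1) \rank E00 <= _)%N; last first.
  by rewrite sum_nat_const card_ord.
elim/big_rec2: _ => [|a k M _ IH]; first by rewrite mxrank0.
apply: leq_trans (mxrank_add _ _) (leq_add _ IH).
exact: leq_trans (mxrankM_maxl _ _) (mxrankM_maxr _ _).
Qed.

Variables (w : nat) (R : 'M[F]_(w.+1, n.+1)) (C : 'M[F]_(n.+1, w.+1)).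
Variables (R' : 'M[F]_(n.+1, w.+1)) (C' : 'M[F]_(w.+1, n.+1)).
Hypotheses (CR : C *m R = E00) (RR' : R *m R' = 1%:M) (C'C : C' *m C = 1%:M).

(** [E00] is only approximately idempotent, so [R *m C] is only near 1; the exact left inverse [C']
    of [C] is used in place of [R]. *)
Definition compress i : 'M[F]_w.+1 := C' *m x i *m C.

Lemma compress_intertwine_l i : apx p (compress i *m R) (R *m x i).
Proof.
have := apx_mull C' (xE i ord0 ord0).
by rewrite -/E00 -CR !mulmxA C'C mul1mx.
Qed.

Lemma compress_intertwine_r i : apx (p + p) (x i *m C) (C *m compress i).
Proof.
have H : apx p (x i *m C) (C *m R *m x i *m R').
  have := apx_mulr R' (xE i ord0 ord0); rewrite -/E00 -CR.
  by rewrite -!mulmxA RR' mulmx1 !mulmxA.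
apply: apx_trans H _.
have := apx_mulr R' (apx_mull C (apx_sym (compress_intertwine_l i))).
by rewrite -!mulmxA RR' mulmx1 !mulmxA.
Qed.

Lemma apx_RC : apx p (R *m C) 1%:M.
Proof.
have := EE ord0 ord0 ord0 ord0; rewrite eqxx mulr1n -/E00 -CR.
move=> /(apx_mull C')/(apx_mulr R').
by rewrite !mulmxA C'C !mul1mx -!mulmxA RR' mulmx1.
Qed.

Variables (w' k : nat) (B : 'I_d -> 'M[F]_w'.+1).
Variables (S : 'M[F]_(w.+1, w'.+1)) (T : 'M[F]_(w'.+1, w.+1)).
Hypotheses (ST : apx k (S *m T) 1%:M) (TS : apx k (T *m S) 1%:M).
Hypothesis xS : forall i, apx k (compress i *m S) (S *m B i).
Variables (N : nat) (iota : 'I_m.+1 -> 'M[F]_(N.+1, w'.+1)).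
Variable pi : 'I_m.+1 -> 'M[F]_(w'.+1, N.+1).
Hypothesis io_pi : block_system iota pi.

(** The unit [E j ord0] leads to the image of [E00], where [S] is applied and the result placed in
    the j-th copy. *)
Definition inflateS := \sum_j E j ord0 *m (C *m S *m pi j).
Definition inflateT := \sum_j (iota j *m T *m R) *m E ord0 j.

Lemma inflate_mulST :
  apx (m.+1 * (k + (p + p)) + p) (inflateS *m inflateT) 1%:M.
Proof.
apply: apx_trans E1; rewrite /inflateS mulmx_suml.
apply: apx_sum_ord => j.
have -> : E j ord0 *m (C *m S *m pi j) *m inflateT =
    E j ord0 *m (C *m (S *m T) *m R) *m E ord0 j.
  rewrite /inflateT mulmx_sumr (bigD1 j) //= [X in _ + X]big1 => [|l nlj].
    rewrite addr0 !mulmxA -[_ *m pi j *m iota j]mulmxA.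
    by rewrite block_proj_incl // eqxx mulmx1.
  rewrite !mulmxA -[_ *m pi j *m iota l]mulmxA block_proj_incl //.
  by rewrite eq_sym (negPf nlj) raddf0 mulmx0 !mul0mx.
apply: apx_trans (apx_mulr _ (apx_mull _ (apx_mulr _ (apx_mull _ ST)))) _.
by rewrite mulmx1 CR; apply: apx_mxunit_split.
Qed.

Lemma inflate_mulTS :
  apx (m.+1 * (m.+1 * p) + m.+1 * (p + p + k)) (inflateT *m inflateS) 1%:M.
Proof.
(* The approximate multiplication table removes the off-diagonal terms; then [R *m E00 *m C] is the
   square of [R *m C], which is near 1. *)
apply: (@apx_trans _ _ _ _ _
  (\sum_a iota a *m (T *m (R *m E00 *m C) *m S) *m pi a)).
  rewrite /inflateT mulmx_suml; apply: apx_sum_ord => a.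
  rewrite /inflateS mulmx_sumr.
  rewrite -(sum_mulrb a (fun b =>
    iota a *m (T *m (R *m E00 *m C) *m S) *m pi b)).
  apply: apx_sum_ord => b.
  have := apx_mulr (C *m S *m pi b) (apx_mull (iota a *m T *m R) (EE ord0 a b ord0)).
  rewrite (eq_sym a) -/E00; case: (b == a) => //=.
    by rewrite !mulr1n !mulmxA.
  by rewrite !mulr0n !mulmx0 !mul0mx !mulmxA.
rewrite -(block_sum io_pi).
apply: apx_sum_ord => a; rewrite -{2}[iota a]mulmx1.
apply/apx_mulr/apx_mull; apply: apx_trans TS.
rewrite -{2}[T]mulmx1; apply/apx_mulr/apx_mull.
rewrite -CR; have -> : R *m (C *m R) *m C = R *m C *m (R *m C) by rewrite !mulmxA.
apply: apx_trans (apx_mull _ apx_RC) _; rewrite mulmx1.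
exact: apx_RC.
Qed.

Definition inflate_coef i := \sum_j iota j *m B i *m pi j.

Lemma proj_inflate_coef j i : pi j *m inflate_coef i = B i *m pi j.
Proof.
rewrite mulmx_sumr (bigD1 j) //= [X in _ + X]big1 => [|l nlj].
  by rewrite addr0 !mulmxA block_proj_incl // eqxx mul1mx.
by rewrite !mulmxA block_proj_incl // eq_sym (negPf nlj) raddf0 !mul0mx.
Qed.

Lemma inflate_coef_apx i :
  apx (m.+1 * (p + (p + p + k))) (x i *m inflateS) (inflateS *m inflate_coef i).
Proof.
rewrite /inflateS mulmx_suml mulmx_sumr; apply: apx_sum_ord => j.
rewrite mulmxA; apply: apx_trans (apx_mulr _ (xE i j ord0)) _.
rewrite -!mulmxA; apply: apx_mull; rewrite proj_inflate_coef !mulmxA.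
apply: apx_mulr; apply: apx_trans (apx_mulr _ (compress_intertwine_r i)) _.
rewrite -(mulmxA C (compress i)) -(mulmxA C S); apply: apx_mull; exact: xS.
Qed.

Lemma inflate_unit_apx a b :
  apx (m.+1 * p) (E a b *m inflateS) (inflateS *m (iota a *m pi b)).
Proof.
have -> : inflateS *m (iota a *m pi b) = E a ord0 *m (C *m S *m pi b).
  rewrite /inflateS mulmx_suml (bigD1 a) //= [X in _ + X]big1 => [|j nja].
    rewrite addr0 !mulmxA -[_ *m pi a *m iota a]mulmxA.
    by rewrite block_proj_incl // eqxx mulmx1.
  rewrite !mulmxA -[_ *m pi j *m iota a]mulmxA block_proj_incl //.
  by rewrite (negPf nja) raddf0 mulmx0 !mul0mx.
rewrite -(sum_mulrb b (fun j => E a ord0 *m (C *m S *m pi j))).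
rewrite /inflateS mulmx_sumr; apply: apx_sum_ord => j.
rewrite mulmxA.
have := apx_mulr (C *m S *m pi j) (EE a b j ord0).
rewrite eq_sym; by case: (j == b); rewrite ?mulr1n ?mulr0n ?mul0mx.
Qed.

End ApproxMatrixUnits.

Section Assembly.
Variables (m d r : nat) (P : 'I_r -> ncpoly F d) (D D' : nat).
Local Notation idx := 'I_m.+1.
Local Notation gen_type := ('I_d + idx * idx)%type.
Local Notation rel_type :=
  ('I_r + 'I_d * (idx * idx) + (idx * idx) * (idx * idx) + unit)%type.
Variables (enc : gen_type -> 'I_D) (dec : 'I_D -> gen_type).
Variables (encr : rel_type -> 'I_D') (decr : 'I_D' -> rel_type).
Hypotheses (encK : cancel enc dec) (decK : cancel dec enc).
Hypothesis encrK : cancel encr decr.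

Lemma nat_stable_mxpres : nat_stable P -> nat_stable (mxpres P enc decr).
Proof.
move=> stP e.
have [CP HCP] : exists C, forall j n n' (X : 'I_d -> 'M[F]_n.+1)
    (X' : 'I_d -> 'M[F]_n'.+1) (S : 'M[F]_(n.+1, n'.+1)) k,
    (forall i, apx k (X i *m S) (S *m X' i)) ->
    apx (C * k) (nceval X (P j) *m S) (S *m nceval X' (P j)).
  apply: unif_bound => [j a b ab HC n n' X X' S k XS | j].
    by apply: apx_le (HC _ _ _ _ _ _ XS); rewrite leq_mul2r ab orbT.
  exact: nceval_intertwine_apx.
have [M ME] : exists M, M = m.+1 by exists m.+1.
(* [c1 * p] bounds the part of every inflation error that depends on [p]; [K0 * p] is the loss in
   [size_le_rank_mxunit]. *)
pose c1 := (M * M + 3 * M + 1)%N; pose K0 := (2 * M + 1)%N.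
have [D0 HD0] := stP (2 * e * M)%N.
exists (D0 * CP.+1 * (2 * M) + 2 * K0 + 2 * e * c1)%N => n Z p Zp Dp.
have rel t : (\rank (nceval Z (mxrel P enc t)) <= p)%N.
  by rewrite -(mxpres_rank _ _ encrK).
pose x i := Z (enc (inl i)); pose E a b := Z (enc (inr (a, b))).
have xE i a b : apx p (x i *m E a b) (E a b *m x i).
  by have := rel (inl (inl (inr (i, (a, b))))); rewrite nceval_mxrel.
have EE a b c l : apx p (E a b *m E c l) (E a l *+ (b == c)).
  by have := rel (inl (inr ((a, b), (c, l)))); rewrite nceval_mxrel.
have E1 : apx p (\sum_a E a a) 1%:M.
  by have := rel (inr tt); rewrite nceval_mxrel.
have xP j : (\rank (nceval x (P j)) <= p)%N.
  by have := rel (inl (inl (inl j))); rewrite nceval_mxrel.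
have := size_le_rank_mxunit EE E1.
set r0 := \rank _ => size_n.
have E0 : E ord0 ord0 != 0.
  rewrite -mxrank_eq0 -/r0; apply/eqP => r00.
  by move: size_n Dp; rewrite /K0 ME; nia.
have [w [R [C [R' [C' [CR RR' C'C rankE]]]]]] := rank_factor E0.
have w_n : (w.+1 <= n.+1)%N by rewrite rankE rank_leq_row.
rewrite /r0 -rankE in size_n.
(* The loss [K0 * p] is at most half of [n.+1], so the corner has proportional size and smallness
   passes to it. *)
have n_w : (n.+1 <= 2 * M * w.+1)%N by move: size_n Dp; rewrite /K0 ME; nia.
have x'P j : (\rank (nceval (compress x C C') (P j)) <= CP.+1 * p)%N.
  have := HCP j _ _ _ _ _ _ (compress_intertwine_l xE CR C'C).
  move=> /(apx_mulr R')/apx_rank.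
  rewrite -[X in (\rank X <= _)%N -> _]mulmxA RR' mulmx1.
  move=> /leq_trans; apply; rewrite mulSn leq_add2r.
  apply: leq_trans (mxrankM_maxl _ _) _.
  exact: leq_trans (mxrankM_maxr _ _) (xP j).
have Dp' : (D0 * (CP.+1 * p) <= w.+1)%N.
  have : (2 * M * (D0 * (CP.+1 * p)) <= 2 * M * w.+1)%N.
    apply: leq_trans n_w; apply: leq_trans Dp; nia.
  by rewrite leq_pmul2l // ME.
have [w' [B [k [BP [S [T [ST TS xS]]] ek]]]] := HD0 _ _ _ x'P Dp'.
have [N [iota [pi [_ sys]]]] := block_system_exists F m w'.
have c1E : (c1 * p = M * (M * p) + 3 * (M * p) + p)%N by rewrite /c1; lia.
pose xt := inflate_coef B iota pi; pose et a b := iota a *m pi b.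
exists N, (mxgen dec xt et), (c1 * p + M * k)%N; split=> [t||].
- rewrite /mxpres nceval_mxrel.
  have eq_x := fun i => mxgen_coef encK xt et i.
  have eq_e := fun a b => mxgen_unit encK xt et a b.
  case: (decr t) => [[[j|[i [a b]]]|[[a b] [c l]]]|[]].
  + rewrite (eq_nceval _ eq_x); apply: (blk_ext sys) => a; rewrite mulmx0.
    rewrite -(nceval_intertwine (P j) (X := B)) ?BP ?mul0mx // => i.
    by rewrite proj_inflate_coef.
  + rewrite eq_x eq_e; apply/eqP; rewrite subr_eq0; apply/eqP.
    apply: (blk_ext sys) => c; rewrite -!mulmxE mulmxA [RHS]mulmxA.
    rewrite (proj_inflate_coef _ sys) /et -(mulmxA (B i)) !(mulmxA (pi c)).
    rewrite (block_proj_incl sys); case: (c == a).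
      by rewrite !mul1mx (proj_inflate_coef _ sys).
    by rewrite raddf0 !mul0mx mulmx0.
  + rewrite !eq_e /et -mulmxE mulmxA -(mulmxA (iota a)) (block_proj_incl sys).
    case: (b == c); first by rewrite mulmx1 subrr.
    by rewrite raddf0 mulmx0 mul0mx subrr.
  + under eq_bigr do rewrite eq_e.
    by rewrite (block_sum sys) subrr.
- exists (inflateS E C S pi), (inflateT E R T iota); split=> [||t].
  + have H := inflate_mulST EE E1 CR ST sys.
    by apply: apx_le H; rewrite c1E -ME !mulnDr;
    move: (M * k)%N (M * (M * p))%N (M * p)%N; lia.
  + have H := inflate_mulTS EE CR RR' C'C TS sys.
    by apply: apx_le H; rewrite c1E -ME !mulnDr;
    move: (M * k)%N (M * (M * p))%N (M * p)%N; lia.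
  + rewrite -(decK t); case: (dec t) => [i|[a b]].
      rewrite mxgen_coef //.
      have H := inflate_coef_apx xE CR RR' C'C xS sys i.
      by apply: apx_le H; rewrite c1E -ME !mulnDr;
    move: (M * k)%N (M * (M * p))%N (M * p)%N; lia.
    rewrite mxgen_unit //.
    have H := inflate_unit_apx EE C S sys a b.
    by apply: apx_le H; rewrite c1E -ME;
    move: (M * k)%N (M * (M * p))%N (M * p)%N; lia.
- have u_n : (2 * (e * (c1 * p)) <= n.+1)%N.
    by apply: leq_trans Dp; rewrite !mulnA leq_mul2r leq_addl orbT.
  have v_n : (2 * (e * (M * k)) <= n.+1)%N.
    by rewrite !mulnA; apply: leq_trans w_n.
  rewrite mulnDr; move: (e * (c1 * p))%N (e * (M * k))%N u_n v_n; lia.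
Qed.

End Assembly.
End ToMatrixAlgebra.

(* m.+1 is the matrix size m >= 1 *)
Theorem theorem7p8 (R : realType) (F : fieldType) (A : algType F) (m : nat)
    (hfp : finitely_presented A) (hrep : has_findim_rep A) :
  rank_stable R A <-> rank_stable R (matalg A m).
Proof.
split=> [[d [r [P [PA stP]]]] | [d' [r' [Q [[psi [psi_surj kerpsi]] stQ]]]]].
  exists _, _, (mxpres (m := m) P (@enum_rank _) (@enum_val _ predT)); split.
    exact: (presents_matalg enum_rankK enum_valK enum_rankK PA).
  apply: rank_stable_of_nat_stable.
  apply: (nat_stable_mxpres enum_rankK enum_valK enum_rankK).
  exact: nat_stable_of_rank_stable stP.
(* Any finite presentations serve in this direction: [P] for [A], and the given [Q] for the matrix
   algebra. *)
have [d [r [P [phi [phi_surj kerphi]]]]] := hfp.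
exists d, r, P; split; first by exists phi.
apply: rank_stable_of_nat_stable.
apply: (nat_stable_of_matalg (fun q => proj1 (kerphi q)) phi_surj _ psi_surj kerpsi).
  by move=> j; apply/kerphi; apply: in_ideal_gen.
exact: nat_stable_of_rank_stable stQ.
Qed.
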